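(* Let $n\ge2$ and let $A=(a_1\ a_2\ \cdots\ a_n)$ be an integer row matrix with $0<a_1<a_2<\cdots<a_n$ and $\gcd(a_1,\dots,a_n)=1$. Let $X=\mathbb{C}^n$, $Y=(x_n=0)\subset X$, $Z=(x_{n-1}=0)\subset X$. Then for all $p\in Y\setminus Z$, $\beta\in\mathbb{C}$ and $s\ge a_n/a_{n-1}$: (i) If $\beta\notin\mathbb{N}$, then $$\mathcal{E}xt^0_{\mathcal{D}_X}(\mathcal{M}_A(\beta),\mathcal{Q}_Y(s))_p=\bigoplus_{j=0}^{a_{n-1}-1}\mathbb{C}\,\overline{(\phi_{v^j|x_0=0})_p}.$$ (ii) If $\beta\in\mathbb{N}$, then there exists a unique $q\in\{0,\dots,a_{n-1}-1\}$ such that $\frac{\beta-q}{a_{n-1}}\in\mathbb{N}$, and $$\mathcal{E}xt^0_{\mathcal{D}_X}(\mathcal{M}_A(\beta),\mathcal{Q}_Y(s))_p=\bigoplus_{0\le j\le a_{n-1}-1,\ j\ne q}\mathbb{C}\,\overline{(\phi_{v^j|x_0=0})_p}\ \oplus\ \mathbb{C}\,\overline{(\phi_{\widetilde{v^q}|x_0=0})_p}.$$ Here $\overline{\phi}$ denotes the class modulo $\mathcal{O}_{X|Y,p}$ of $\phi\in\mathcal{O}_{\widehat{X|Y},p}(s)$.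
   Context: $\mathbb{N}=\{0,1,2,\dots\}$. Hypergeometric system: $X=\mathbb{C}^n$ with coordinates $x_1,\dots,x_n$; $\mathcal{O}_X$ is the sheaf of holomorphic functions and $\mathcal{D}_X$ the sheaf of linear differential operators with holomorphic coefficients; $\partial_i=\partial/\partial x_i$. For a row matrix $A=(a_1\ \cdots\ a_n)$ of positive integers and $\beta\in\mathbb{C}$, $I_A\subset\mathbb{C}[\partial_1,\dots,\partial_n]$ is the toric ideal generated by all $\partial^{u_+}-\partial^{u_-}$, where $u\in\mathbb{Z}^n$, $Au=0$, $u=u_+-u_-$ with $u_\pm\in\mathbb{N}^n$ of disjoint support. $H_A(\beta)$ is the left ideal of the Weyl algebra $A_n(\mathbb{C})$ generated by $I_A$ and $E(\beta)=\sum_{j=1}^n a_jx_j\partial_j-\beta$, and $\mathcal{M}_A(\beta)=\mathcal{D}_X/\mathcal{D}_XH_A(\beta)$. Gevrey sheaves: $\mathcal{O}_{X|Y}$ is the restriction of $\mathcal{O}_X$ to $Y=(x_n=0)$, and $\mathcal{O}_{\widehat{X|Y}}=\varprojlim_k\mathcal{O}_X/(x_n^k)$. For real $s\ge1$, $\mathcal{O}_{\widehat{X|Y}}(s)$ is the subsheaf of Gevrey series of order $s$: a germ $f=\sum_{i\ge0}f_i(x_1,\dots,x_{n-1})x_n^i$ at $p\in Y$ lies in it iff $\sum_{i\ge0}\frac{1}{(i!)^{s-1}}f_i x_n^i$ converges at $p$. Put $\mathcal{O}_{\widehat{X|Y}}(\infty)=\mathcal{O}_{\widehat{X|Y}}$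 and $\mathcal{Q}_Y(s)=\mathcal{O}_{\widehat{X|Y}}(s)/\mathcal{O}_{X|Y}$, a left $\mathcal{D}_X$-module. $\mathcal{E}xt^0_{\mathcal{D}_X}(\mathcal{M}_A(\beta),\mathcal{Q}_Y(s))_p$ is identified with the space of $f\in\mathcal{Q}_Y(s)_p$ annihilated by $H_A(\beta)$. $\Gamma$-series: let $A'=(1\ a_1\ \cdots\ a_n)$, associated with variables $x'=(x_0,x_1,\dots,x_n)$, and $L_{A'}=\{u\in\mathbb{Z}^{n+1}:A'u=0\}$. For $z\in\mathbb{C}^{n+1}$, $\alpha\in\mathbb{N}^{n+1}$ let $(z)_\alpha=\prod_{i:\alpha_i>0}\prod_{l=0}^{\alpha_i-1}(z_i-l)$. For $v\in\mathbb{C}^{n+1}$ let $\mathrm{nsupp}(v)=\{i:v_i\in\mathbb{Z}_{<0}\}$, $N_v=\{u\in L_{A'}:\mathrm{nsupp}(v+u)=\mathrm{nsupp}(v)\}$ and $\phi_v=(x')^v\sum_{u\in N_v}\frac{(v)_{u_-}}{(v+u)_{u_+}}(x')^u$. Positions are indexed by $0,\dots,n$. For $0\le j\le a_{n-1}-1$, $v^j\in\mathbb{C}^{n+1}$ has entry $j$ in position $0$, entry $\frac{\beta-j}{a_{n-1}}$ in position $n-1$, and zeros elsewhere. For $\beta\in\mathbb{N}$ and $q$ as in (ii), $\widetilde{v^q}\in\mathbb{C}^{n+1}$ has entry $\beta+a_{n-1}$ in position $0$, entry $-1$ in position $n-1$, and zeros elsewhere. The notation $\phi_{|x_0=0}$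 means substitution of $x_0=0$. Explicitly, with $(z)_m=z(z-1)\cdots(z-m+1)$, $$\phi_{v^j|x_0=0}=\sum_{\substack{(m_1,\dots,m_n)\in\mathbb{N}^n\\ \sum_{i\ne n-1}a_im_i=j+a_{n-1}m_{n-1}}}\frac{\big(\frac{\beta-j}{a_{n-1}}\big)_{m_{n-1}}j!}{\prod_{i\ne n-1}m_i!}\;x_{n-1}^{\frac{\beta-j}{a_{n-1}}-m_{n-1}}\prod_{i\ne n-1}x_i^{m_i},$$ $$\phi_{\widetilde{v^q}|x_0=0}=\sum_{\substack{(m_1,\dots,m_n)\in\mathbb{N}^n\\ \sum_{i\ne n-1}a_im_i=\beta+a_{n-1}+a_{n-1}m_{n-1}}}\frac{(-1)^{m_{n-1}}m_{n-1}!\,(\beta+a_{n-1})!}{\prod_{i\ne n-1}m_i!}\;x_{n-1}^{-1-m_{n-1}}\prod_{i\ne n-1}x_i^{m_i}.$$ For $p\in Y\setminus Z$, $(\cdot)_p$ denotes the germ at $p$, viewed as a series in $x_n$ with coefficients holomorphic near $p$ (for a chosen branch of $x_{n-1}^{(\beta-j)/a_{n-1}}$ near $p$). *)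

(* Defs.v *)
From mathcomp Require Import all_boot all_order all_algebra.
From mathcomp Require Import complex.
From mathcomp Require Import all_classical all_reals all_analysis.

Set Implicit Arguments.
Unset Strict Implicit.
Unset Printing Implicit Defensive.

Import Order.TTheory GRing.Theory Num.Theory.
Import numFieldNormedType.Exports.

Local Open Scope classical_set_scope.
Local Open Scope complex_scope.
Local Open Scope ring_scope.

Definition cexp (R : realType) (z : R[i]) : R[i] :=
  (expR (complex.Re z) * cos (complex.Im z)) +i*
  (expR (complex.Re z) * sin (complex.Im z)).

(* (z)_m = z (z - 1) ... (z - m + 1) *)
Definition cffact (R : realType) (z : R[i]) (m : nat) : R[i] :=
  \prod_(l < m) (z - l%:R).

Definition mindex (n : nat) := {ffun 'I_n -> nat}.

Definition mdeg (n : nat) (al : mindex n) : nat := (\sum_i al i)%N.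

(* Formal power series in t = x - p. A germ at p is identified with its Taylor
   series at p, so all stalks at p below are spaces of such series. *)
Definition fps (R : realType) (n : nat) := mindex n -> R[i].

Definition fscale (R : realType) (n : nat) (c : R[i]) (f : fps R n) : fps R n :=
  fun al => c * f al.

(* multiplication by the coordinate x_j = p_j + t_j *)
Definition opX (R : realType) (n : nat) (p : 'rV[R[i]]_n) (j : 'I_n)
    (f : fps R n) : fps R n :=
  fun al => p 0 j * f al +
    (if (0 < al j)%N then f [ffun i => al i - (i == j)]%N else 0).

Definition opD (R : realType) (n : nat) (j : 'I_n) (f : fps R n) : fps R n :=
  fun al => (al j).+1%:R * f [ffun i => al i + (i == j)]%N.

Definition opD_mon (R : realType) (n : nat) (al : mindex n) (f : fps R n) :
    fps R n :=
  foldr (fun j g => iter (al j) (opD j) g) f (enum 'I_n).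

Definition oper (R : realType) (n : nat) := fps R n -> fps R n.

Inductive subalg (R : realType) (n : nat) (G : set (oper R n)) : oper R n -> Prop :=
| subalg_gen P : G P -> subalg G P
| subalg_scalar c : subalg G (fscale c)
| subalg_add P Q : subalg G P -> subalg G Q -> subalg G (fun f => P f + Q f)
| subalg_mul P Q : subalg G P -> subalg G Q -> subalg G (fun f => P (Q f)).

Inductive left_ideal (R : realType) (n : nat) (B G : set (oper R n)) :
    oper R n -> Prop :=
| left_ideal_gen P : G P -> left_ideal B G P
| left_ideal_0 : left_ideal B G (fun=> 0)
| left_ideal_add P Q :
    left_ideal B G P -> left_ideal B G Q -> left_ideal B G (fun f => P f + Q f)
| left_ideal_mul P Q :
    B P -> left_ideal B G Q -> left_ideal B G (fun f => P (Q f)).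

(* C[d_1, ..., d_n] and the Weyl algebra A_n(C), through their faithful action
   on power series at p. *)
Definition diff_ops (R : realType) (n : nat) : set (oper R n) :=
  subalg [set P | exists j, P = opD j].

Definition weyl (R : realType) (n : nat) (p : 'rV[R[i]]_n) : set (oper R n) :=
  subalg [set P | exists j, P = opX p j \/ P = opD j].

Definition pos_part (n : nat) (u : 'I_n -> int) : mindex n :=
  [ffun i => `|Num.max (u i) 0|%N].

Definition neg_part (n : nat) (u : 'I_n -> int) : mindex n :=
  [ffun i => `|Num.max (- u i) 0|%N].

Definition toric_ideal (R : realType) (n : nat) (a : 'I_n -> nat) :
    set (oper R n) :=
  left_ideal (@diff_ops R n)
    [set P | exists u : 'I_n -> int, \sum_i (a i)%:Z * u i = 0 /\
       P = fun f => opD_mon (pos_part u) f - opD_mon (neg_part u) f].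

Definition euler_op (R : realType) (n : nat) (a : 'I_n -> nat)
    (p : 'rV[R[i]]_n) (beta : R[i]) : oper R n :=
  fun f => \sum_j fscale (a j)%:R (opX p j (opD j f)) - fscale beta f.

Definition hyper_ideal (R : realType) (n : nat) (a : 'I_n -> nat)
    (p : 'rV[R[i]]_n) (beta : R[i]) : set (oper R n) :=
  left_ideal (weyl p)
    (@toric_ideal R n a `|` [set euler_op a p beta]).

(* Stalk at p of O_X, i.e. of O_{X|Y} when p lies in Y. *)
Definition convergent (R : realType) (n : nat) : set (fps R n) :=
  [set f | exists2 r : R, 0 < r &
     (\esum_(al in [set: mindex n]) (Normc.normc (f al) * r ^+ mdeg al)%:E
        < +oo)%E].

(* Stalk of the formal completion of O_X along Y = (x_n = 0) at a point of Y:
   the coefficients of all the powers of x_n converge on a common polydisc. *)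
Definition formal_along (R : realType) (n : nat) : set (fps R n.+1) :=
  [set f | exists2 r : R, 0 < r & forall k : nat,
     (\esum_(al in [set al : mindex n.+1 | al ord_max = k])
        (Normc.normc (f al) * r ^+ mdeg al)%:E < +oo)%E].

Definition gevrey (R : realType) (n : nat) (s : \bar R) : set (fps R n.+1) :=
  match s with
  | EFin r =>
      [set f | convergent (fun al =>
         f al / (((al ord_max)`!%:R : R) `^ (r - 1))%:C)]
  | +oo%E => @formal_along R n
  | -oo%E => set0
  end.

(* The f in the stalk of O_{X^|Y}(s) whose class in Q_Y(s) is annihilated by
   H_A(beta), i.e. the preimage of Ext^0(M_A(beta), Q_Y(s))_p. *)
Definition ext0_lift (R : realType) (n : nat) (a : 'I_n.+1 -> nat)
    (p : 'rV[R[i]]_n.+1) (beta : R[i]) (s : \bar R) : set (fps R n.+1) :=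
  [set f | gevrey s f /\ forall P, hyper_ideal a p beta P -> convergent (P f)].

(* V / convergent is the direct sum of the lines spanned by the nonzero classes
   of the g j. *)
Definition direct_sum_mod_convergent (R : realType) (n N : nat)
    (V : set (fps R n)) (g : 'I_N -> fps R n) : Prop :=
  V = [set f | exists c : 'I_N -> R[i],
         convergent (f - \sum_j fscale (c j) (g j))] /\
  (forall c : 'I_N -> R[i],
     convergent (\sum_j fscale (c j) (g j)) -> forall j, c j = 0).

(* the 0-based position of a_{n-1}; that of a_n is ord_max *)
Definition penult (n : nat) : 'I_n.+2 := inord n.

(* Sum of an absolutely convergent family, as a limit of sums over boxes. *)
Definition csum (R : realType) (n : nat) (F : mindex n -> R[i]) : R[i] :=
  let S (N : nat) : R[i] :=
    \sum_(m : {ffun 'I_n -> 'I_N}) F [ffun i => nat_of_ord (m i)] in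
  (limn (fun N => complex.Re (S N) : R)) +i* (limn (fun N => complex.Im (S N) : R)).

(* Taylor coefficients at z0 of the branch exp (c * log z) of z^c for which
   log z0 = l. *)
Definition cpow_taylor (R : realType) (l c : R[i]) (k : nat) : R[i] :=
  cffact c k / k`!%:R * cexp ((c - k%:R) * l).

(* Taylor coefficient at p of x^m with the factor x_{n-1}^{m_{n-1}} removed. *)
Definition mon_taylor (R : realType) (n : nat) (p : 'rV[R[i]]_n.+2)
    (m al : mindex n.+2) : R[i] :=
  \prod_(i | i != penult n) ('C(m i, al i)%:R * p 0 i ^+ (m i - al i)).

Definition weight_but (n : nat) (a : 'I_n.+2 -> nat) (m : mindex n.+2) : nat :=
  (\sum_(i | i != penult n) a i * m i)%N.

Definition fact_but (n : nat) (m : mindex n.+2) : nat :=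
  (\prod_(i | i != penult n) (m i)`!)%N.

(* Taylor series at p of phi_{v^j} at x_0 = 0; l is the value at p of the
   chosen logarithm of x_{n-1}. *)
Definition phi (R : realType) (n : nat) (a : 'I_n.+2 -> nat)
    (p : 'rV[R[i]]_n.+2) (beta l : R[i]) (j : nat) : fps R n.+2 :=
  let g := (beta - j%:R) / (a (penult n))%:R in
  fun al => csum (fun m =>
    if weight_but a m == (j + a (penult n) * m (penult n))%N then
      cffact g (m (penult n)) * j`!%:R / (fact_but m)%:R
      * cpow_taylor l (g - (m (penult n))%:R) (al (penult n))
      * mon_taylor p m al
    else 0).

(* The same for the modified vector attached to v^q, when beta = b is a natural
   number; the exponent of x_{n-1} is then an integer. *)
Definition phi_tilde (R : realType) (n : nat) (a : 'I_n.+2 -> nat)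
    (p : 'rV[R[i]]_n.+2) (b : nat) : fps R n.+2 :=
  fun al => csum (fun m =>
    let k := m (penult n) in let d := al (penult n) in
    if weight_but a m == (b + a (penult n) + a (penult n) * k)%N then
      (-1) ^+ k * k`!%:R * (b + a (penult n))`!%:R / (fact_but m)%:R
      * (cffact (- k.+1%:R) d / d`!%:R * p 0 (penult n) ^- (k.+1 + d))
      * mon_taylor p m al
    else 0).

(* Main.v *)
(* Write c_al = al! f_al for the Taylor coefficients of f at p and, for d : nat -> C,
   let wseries d be the series with c_al = d (a . al).  Trading letters with the
   help of the Apery set of the semigroup spanned by the a_i, the toric equations
   modulo convergent series say exactly that f is some wseries d modulo
   convergent series, and then the Euler operator acts on d by the recurrence
     rho d w = sum_i a_i p_i d (w + a_i) - (beta - w) d w.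
   Since p_n = 0 this recurrence has order k = a_{n-1}, while wseries d converges
   iff d grows at most like (w!)^(1/a_n).  In that range rho is, for large w,
   dominated by (beta - w) d w, so by contraction rho d = eps is solvable for
   every eps of such growth, and a solution of rho d = 0 of such growth vanishes
   for large w.  Hence the space in question is that of solutions of rho d = 0
   for large w, of dimension at most k.  The series phi_{v^j}, and phi of the
   modified vector, correspond to d = exp (sum_{i <> n-1} p_i T^(a_i)) d0, where T
   is the shift and d0 is supported on one residue class modulo k; multiplying
   by exp (- sum p_i T^(a_i)) shows that they are independent. *)
Require Import Defs.
From mathcomp Require Import all_boot all_order all_algebra.
From mathcomp Require Import complex.
From mathcomp Require Import all_classical all_reals all_analysis.
From mathcomp Require Import zify ring lra.

Set Implicit Arguments.
Unset Strict Implicit.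
Unset Printing Implicit Defensive.

Import Order.TTheory GRing.Theory Num.Theory.
Import numFieldNormedType.Exports.

Local Open Scope classical_set_scope.
Local Open Scope complex_scope.
Local Open Scope ring_scope.

(** * Growth weights *)

(** Growth is measured against (w!)^(1/c): a shift by b < c multiplies this weight by at most (w +
    b)^(1 - 1/c), which is o(w). The estimate serves at two scales. With c = a_n, it makes the
    diagonal term (beta - w) d w dominate, because p_n = 0 leaves only shifts a_i < a_n. With c =
    a_{n-1}, it makes exp (sum p_i T^(a_i)) d0 converge although d0 itself may grow like
    (w!)^(1/a_{n-1}); the index n-1 must stay out of this exponential, since there decay and growth
    would be of the same order. Conjugation by the exponential leaves the two-term recurrence k
    p_{n-1} d (w + k) = (beta - w) d w, whose solutions are the falling factorials of the
    Gamma-series. The order a_n / a_{n-1} is the ratio of the two scales: a sequence of the second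
    scale gives a series of exactly that Gevrey bound, so the space is the same for every larger
    s. *)

Lemma fact_addn_le w b : ((w + b)`! <= w`! * (w + b) ^ b)%N.
Proof.
elim: b => [|b IH]; first by rewrite addn0 expn0 muln1.
rewrite addnS factS expnS mulnCA leq_mul2l /=; apply: leq_trans IH _.
rewrite leq_mul2l; apply/orP; right; case: b => [//|b]; rewrite leq_exp2r //.
Qed.

Lemma fact_addn_ge w b : (w`! * w.+1 ^ b <= (w + b)`!)%N.
Proof.
elim: b => [|b IH]; first by rewrite addn0 expn0 muln1.
by rewrite addnS factS expnS mulnCA leq_mul // ltnS leq_addr.
Qed.

Lemma fact_exp_le c m : (m`! ^ c <= (c * m)`!)%N.
Proof.
elim: m => [|m IH]; first by rewrite muln0 fact0 exp1n.
rewrite factS expnMn mulnS addnC mulnC.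
apply: leq_trans (fact_addn_ge _ _); apply: leq_mul => //.
case: c {IH} => // c; rewrite leq_exp2r // ltnS; exact: leq_pmull.
Qed.

Lemma fact_mul_le c T : ((c * T)`! <= c ^ (c * T) * T`! ^ c)%N.
Proof.
elim: T => [|T IH]; first by rewrite muln0 expn0 fact0 exp1n.
rewrite mulnS addnC; apply: leq_trans (fact_addn_le _ _) _.
apply: leq_trans (leq_mul IH (leqnn _)) _.
by rewrite [(c * T + c)%N]addnC -mulnS factS !expnMn mulnS expnD; lia.
Qed.

Lemma fact_add_le x y : ((x + y)`! <= 2 ^ (x + y) * (x`! * y`!))%N.
Proof.
rewrite -(bin_fact (leq_addr y x)) addKn leq_mul2r; apply/orP; right.
rewrite -[2%N]/(1 + 1)%N expnDn (bigD1 (inord x)) //= !exp1n !muln1 inordK.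
  exact: leq_addr.
by rewrite ltnS leq_addr.
Qed.

Section Weights.
Variable R : realType.
Implicit Types c w s b : nat.

Definition root c (x : R) : R := x `^ c%:R^-1.

(** Up to geometric factors [mu c (c * T)] is T!. With c = a_n this scale characterises convergence;
    with c = a_{n-1} it bounds the Gamma-series. *)
Definition mu c w : R := root c w`!%:R.

Lemma root_ge0 c x : 0 <= root c x. Proof. exact: powR_ge0. Qed.

Lemma root_le c x y : 0 <= x -> x <= y -> root c x <= root c y.
Proof. by move=> x0 xy; apply: ge0_ler_powR; rewrite ?nnegrE ?invr_ge0 // (le_trans x0). Qed.

Lemma rootX c (y : R) : (0 < c)%N -> 0 <= y -> root c (y ^+ c) = y.
Proof.
move=> c0 y0; rewrite /root -powR_mulrn // -powRrM divff ?powRr1 //.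
by rewrite pnatr_eq0 -lt0n.
Qed.

Lemma rootM c (x y : R) : 0 <= x -> 0 <= y -> root c (x * y) = root c x * root c y.
Proof. by move=> *; rewrite /root powRM. Qed.

Lemma root_le_self c (x : R) : 1 <= x -> root c x <= x.
Proof.
move=> x1; rewrite -[leRHS]powRr1 ?(le_trans ler01) //; apply: ler_powR => //.
(* For c = 0 the exponent is 0^-1 = 0, and the claim is still true. *)
case: c => [|c]; first by rewrite invr0.
by rewrite invf_le1 ?ltr0n // ler1n.
Qed.

Lemma root_unbounded c (B : R) : (0 < c)%N ->
  exists V : nat, forall v : nat, (V <= v)%N -> B <= root c v%:R.
Proof.
move=> c0; have B0 : 0 <= Num.max B 0 by rewrite le_max lexx orbT.
exists (Num.truncn (Num.max B 0 ^+ c)).+1 => v Vv.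
apply: (@le_trans _ _ (Num.max B 0)); first by rewrite le_max lexx.
rewrite -[leLHS](rootX c0) //; apply: root_le; first exact: exprn_ge0.
apply: le_trans (ltW (truncnS_gt _)) _; by rewrite ler_nat.
Qed.

Lemma mu_gt0 c w : 0 < mu c w.
Proof. by rewrite /mu /root powR_gt0 // ltr0n fact_gt0. Qed.

Lemma mu_ge0 c w : 0 <= mu c w. Proof. exact: ltW (mu_gt0 _ _). Qed.

Lemma mu_le c w s : (w <= s)%N -> mu c w <= mu c s.
Proof. by move=> ws; apply: root_le => //; rewrite ler_nat; apply: leq_fact. Qed.

Lemma mu_ge1 c w : 1 <= mu c w.
Proof. by apply: le_trans (mu_le c (leq0n w)); rewrite /mu fact0 /root powR1. Qed.

Lemma mu_le_fact c T w : (0 < c)%N -> (w <= c * T)%N ->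
  mu c w <= c%:R ^+ T * T`!%:R.
Proof.
move=> c0 wT; apply: le_trans (mu_le c wT) _.
rewrite -[leRHS](rootX c0) ?mulr_ge0 ?exprn_ge0 //; apply: root_le => //.
by rewrite exprMn -exprM -!natrX -natrM ler_nat [(T * c)%N]mulnC fact_mul_le.
Qed.

Lemma mu_ge_fact c m : (0 < c)%N -> m`!%:R <= mu c (c * m).
Proof.
move=> c0; rewrite -[leLHS](rootX c0) //; apply: root_le; first exact: exprn_ge0.
by rewrite -natrX ler_nat fact_exp_le.
Qed.

Lemma muD c w s : mu c (w + s) <= 2 ^+ (w + s) * (mu c w * mu c s).
Proof.
rewrite /mu -rootM //; apply: (@le_trans _ _ (root c (2 ^+ (w + s)) * root c (w`!%:R * s`!%:R))).
  rewrite -rootM ?mulr_ge0 ?exprn_ge0 //; apply: root_le => //.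
  by rewrite -natrX -!natrM ler_nat fact_add_le.
apply: ler_wpM2r; first exact: root_ge0.
by apply: root_le_self; rewrite exprn_ege1 // ler1n.
Qed.

(** From (w+b)! <= w! (w+b)^b and b + 1 <= c. The gain of one root of w + b over the linear factor
    is what every contraction and decay estimate below consumes. *)
Lemma mu_ratio c b w : (b < c)%N ->
  mu c (w + b) * root c (w + b)%:R <= mu c w * (w + b)%:R.
Proof.
move=> bc; have c0 : (0 < c)%N by apply: leq_ltn_trans bc.
rewrite /mu -rootM // -[X in _ <= _ * X](rootX c0) // -rootM ?exprn_ge0 //.
apply: root_le; rewrite ?mulr_ge0 //.
rewrite -natrX -!natrM ler_nat.
case: (posnP (w + b)) => [->|wb0]; first by rewrite muln0.
apply: leq_trans (leq_mul (fact_addn_le w b) (leqnn _)) _.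
by rewrite -mulnA leq_mul2l -expnSr leq_pexp2l // orbT.
Qed.

End Weights.

(** * Limits of complex sequences *)

Notation nm := Normc.normc.

Section ComplexLimits.
Variable R : realType.
Notation C := R[i].
Implicit Types (x y z L : C) (u v : nat -> C).

Lemma nm_ge0 x : 0 <= nm x. Proof. by case: x => a b; apply: sqrtr_ge0. Qed.

Lemma nmD x y : nm (x + y) <= nm x + nm y. Proof. exact: le_normcD. Qed.

Lemma nmB x y : nm (x - y) <= nm x + nm y.
Proof. by rewrite -[nm y]normcN nmD. Qed.

Lemma nm_distC x y : nm (x - y) = nm (y - x).
Proof. by rewrite -normcN opprB. Qed.

Lemma nm_distD z x y : nm (x - y) <= nm (x - z) + nm (z - y).
Proof. by apply: le_trans (nmD _ _); rewrite addrA subrK. Qed.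

Lemma nm_sum (I : Type) (r : seq I) (P : pred I) (F : I -> C) :
  nm (\sum_(i <- r | P i) F i) <= \sum_(i <- r | P i) nm (F i).
Proof.
elim/big_rec2: _ => [|i y x _ IH]; first by rewrite Normc.normc0.
by apply: le_trans (nmD _ _) _; rewrite lerD2l.
Qed.

Lemma nmX x m : nm (x ^+ m) = nm x ^+ m.
Proof. by elim: m => [|m IH]; rewrite ?expr0 ?Normc.normc1 // !exprS Normc.normcM IH. Qed.

Lemma nm_real (r : R) : nm r%:C = `|r|.
Proof. by rewrite /Normc.normc /= expr0n /= addr0 sqrtr_sqr. Qed.

Lemma nm_nat m : nm m%:R = m%:R :> R.
Proof.
by rewrite -[m%:R]/((1 : C) *+ m) normcMn Normc.normc1.
Qed.

Lemma nm_gt0 x : x != 0 -> 0 < nm x.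
Proof.
move=> x0; rewrite lt_neqAle nm_ge0 andbT eq_sym.
by apply: contra x0 => /eqP/Normc.eq0_normc/eqP.
Qed.

Lemma Re_le_nm x : `|complex.Re x| <= nm x.
Proof.
case: x => a b /=; rewrite -sqrtr_sqr; apply: ler_wsqrtr.
by rewrite lerDl sqr_ge0.
Qed.

Lemma Im_le_nm x : `|complex.Im x| <= nm x.
Proof.
case: x => a b /=; rewrite -sqrtr_sqr; apply: ler_wsqrtr.
by rewrite lerDr sqr_ge0.
Qed.

Lemma nm_le_ReIm x : nm x <= `|complex.Re x| + `|complex.Im x|.
Proof.
rewrite [x]complexE; apply: le_trans (nmD _ _) _.
rewrite Normc.normcM !nm_real lerD //= ?addr0 ?add0r ?mul0r ?mul1r ?subr0.
  by case: x => a b /=; rewrite !(mul0r, mulr0, mul1r, subr0, addr0).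
case: x => a b /=; rewrite !(mul0r, mulr0, mul1r, subr0, addr0, add0r, expr0n, expr1n) /=.
by rewrite sqrtr1 mul1r.
Qed.

Definition clim u L := forall e : R, 0 < e ->
  exists N0 : nat, forall N, (N0 <= N)%N -> nm (u N - L) < e.

Lemma clim_unique u L1 L2 : clim u L1 -> clim u L2 -> L1 = L2.
Proof.
move=> h1 h2; apply/eqP; rewrite -subr_eq0; apply/negPn/negP => /nm_gt0 d0.
have [N1 H1] := h1 _ (divr_gt0 d0 (ltr0n _ 2)).
have [N2 H2] := h2 _ (divr_gt0 d0 (ltr0n _ 2)).
have := H1 _ (leq_maxl N1 N2); have := H2 _ (leq_maxr N1 N2).
have := nm_distD (u (maxn N1 N2)) L1 L2; rewrite (nm_distC L1 (u _)); lra.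
Qed.

Lemma clim_cst L : clim (fun=> L) L.
Proof. by move=> e e0; exists 0%N => N _; rewrite subrr Normc.normc0. Qed.

Lemma climD u v L1 L2 : clim u L1 -> clim v L2 -> clim (fun N => u N + v N) (L1 + L2).
Proof.
move=> h1 h2 e e0.
have [N1 H1] := h1 _ (divr_gt0 e0 (ltr0n _ 2)).
have [N2 H2] := h2 _ (divr_gt0 e0 (ltr0n _ 2)).
exists (maxn N1 N2) => N; rewrite geq_max => /andP[/H1 ? /H2 ?].
have -> : u N + v N - (L1 + L2) = (u N - L1) + (v N - L2) by ring.
apply: le_lt_trans (nmD _ _) _; lra.
Qed.

Lemma climZ c u L : clim u L -> clim (fun N => c * u N) (c * L).
Proof.
move=> h e e0; have d0 : 0 < nm c + 1 by rewrite ltr_wpDl ?nm_ge0.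
have [N1 H1] := h _ (divr_gt0 e0 d0).
exists N1 => N /H1; rewrite -mulrBr Normc.normcM ltr_pdivlMr // => h1.
by apply: le_lt_trans h1; rewrite mulrC ler_wpM2l ?nm_ge0 // lerDl.
Qed.

Lemma climN u L : clim u L -> clim (fun N => - u N) (- L).
Proof.
by move=> h e /h [N1 H1]; exists N1 => N /H1; rewrite -opprD normcN.
Qed.

Lemma clim_ext u v L : (forall N, u N = v N) -> clim u L -> clim v L.
Proof. by move=> /funext ->. Qed.

Lemma clim_sum (I : Type) (r : seq I) (P : pred I) (F : I -> nat -> C) (G : I -> C) :
  (forall i, P i -> clim (F i) (G i)) ->
  clim (fun N => \sum_(i <- r | P i) F i N) (\sum_(i <- r | P i) G i).
Proof.
move=> h; elim: r => [|i r IH].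
  by rewrite big_nil; apply: clim_ext (clim_cst 0) => N; rewrite big_nil.
rewrite big_cons; case: ifP => Pi; last first.
  by apply: clim_ext IH => N; rewrite big_cons Pi.
by apply: clim_ext (climD (h _ Pi) IH) => N; rewrite big_cons Pi.
Qed.

Lemma clim_subn m u L : clim u L -> clim (fun N => u (N - m)%N) L.
Proof.
move=> h e /h [N0 H]; exists (N0 + m)%N => N hN; apply: H; lia.
Qed.

Lemma clim_near N1 u v L : (forall N, (N1 <= N)%N -> u N = v N) -> clim u L -> clim v L.
Proof.
move=> uv h e /h [N0 H]; exists (maxn N0 N1) => N; rewrite geq_max => /andP[a b].
by rewrite -uv // H.
Qed.

Lemma exprV2_small (e : R) : 0 < e -> exists N0 : nat, forall N, (N0 <= N)%N ->
  2^-1 ^+ N < e.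
Proof.
move=> e0; exists (Num.truncn e^-1).+1 => N hN.
rewrite exprVn -[ltRHS]invrK ltf_pV2 ?posrE ?invr_gt0 ?exprn_gt0 //.
apply: lt_le_trans (truncnS_gt _) _; apply: (@le_trans _ _ N%:R); first by rewrite ler_nat.
by rewrite -natrX ler_nat ltnW // ltn_expl.
Qed.

Lemma clim_geom m B u L :
  (forall N, (m <= N)%N -> nm (u N - L) <= B * 2^-1 ^+ (N - m)) -> clim u L.
Proof.
move=> h e e0; have d0 : 0 < `|B| + 1 by rewrite ltr_wpDl.
have [N0 H] := exprV2_small (divr_gt0 e0 d0).
exists (N0 + m)%N => N hN; apply: le_lt_trans (h _ _) _; first by lia.
have /H : (N0 <= N - m)%N by lia.
rewrite ltr_pdivlMr // => {}H; apply: le_lt_trans H.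
rewrite [leRHS]mulrC; apply: ler_wpM2r; first by rewrite exprn_ge0.
by apply: le_trans (ler_norm _) _; rewrite lerDl.
Qed.

Lemma clim_le B u L : clim u L -> (forall N, nm (u N) <= B) -> nm L <= B.
Proof.
move=> h uB; apply/ler_addgt0Pl => e /h [N0 /(_ _ (leqnn _)) H].
have := nm_distD (u N0) L 0; rewrite !subr0 nm_distC; have := uB N0; lra.
Qed.

(** Links the epsilon-style limit to the componentwise [limn] in which [csum] and [etrans] are
    defined. *)
Lemma clim_lim u L : clim u L ->
  (limn (fun N => complex.Re (u N) : R)) +i* (limn (fun N => complex.Im (u N) : R)) = L.
Proof.
move=> h; rewrite [RHS](complexE L).
have rE z : z = complex.Re z +i* complex.Im z by case: z.
have -> : limn (fun N => complex.Re (u N) : R) = complex.Re L.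
  apply/cvg_lim => //; apply/cvgrPdist_lt => e /h [N0 H].
  exists N0 => // N /= /H; rewrite nm_distC; apply: le_lt_trans.
  by apply: le_trans (Re_le_nm _); case: (u N) (L) => ? ? [].
have -> : limn (fun N => complex.Im (u N) : R) = complex.Im L.
  apply/cvg_lim => //; apply/cvgrPdist_lt => e /h [N0 H].
  exists N0 => // N /= /H; rewrite nm_distC; apply: le_lt_trans.
  by apply: le_trans (Im_le_nm _); case: (u N) (L) => ? ? [].
by rewrite -complexE -rE.
Qed.

Lemma real_geom_cauchy (u : nat -> R) (B : R) :
  (forall N, `|u N.+1 - u N| <= B * 2^-1 ^+ N) ->
  exists l, forall N, `|u N - l| <= 2 * B * 2^-1 ^+ N.
Proof.
move=> h.
(* The margin 2 B / 2^N shrinks by exactly B / 2^N at each step, which absorbs the step of u: v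
   increases, w decreases, and the sup of v lies between them. *)
pose v N := u N - 2 * B * 2^-1 ^+ N; pose w N := u N + 2 * B * 2^-1 ^+ N.
have vS N : v N <= v N.+1.
  by have := h N; rewrite /v exprS ler_norml => /andP[]; lra.
have wS N : w N.+1 <= w N.
  by have := h N; rewrite /w exprS ler_norml => /andP[]; lra.
have vw N : v N <= w N.
  have := le_trans (normr_ge0 _) (h N); rewrite /v /w; lra.
have vle m j : v m <= v (m + j)%N.
  by elim: j => [|j IH]; rewrite ?addn0 // addnS; apply: le_trans IH (vS _).
have wle m j : w (m + j)%N <= w m.
  by elim: j => [|j IH]; rewrite ?addn0 // addnS; apply: le_trans (wS _) IH.
have vwle m j : v m <= w j.
  apply: le_trans (vle m j) _; apply: le_trans (vw _) _; rewrite addnC; exact: wle.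
have hs : has_sup (range v).
  by split; [exists (v 0%N), 0%N | exists (w 0%N) => _ [m _ <-]].
exists (sup (range v)) => N.
have h1 : v N <= sup (range v) by apply: sup_upper_bound => //; exists N.
have h2 : sup (range v) <= w N by apply: ge_sup; [case: hs | move=> _ [m _ <-]].
by move: h1 h2; rewrite /v /w ler_norml => h1 h2; apply/andP; split; lra.
Qed.

Lemma geom_cauchy u (B : R) : (forall N, nm (u N.+1 - u N) <= B * 2^-1 ^+ N) ->
  exists L, forall N, nm (u N - L) <= 4 * B * 2^-1 ^+ N.
Proof.
move=> h.
have [r Hr] : exists l, forall N, `|complex.Re (u N) - l| <= 2 * B * 2^-1 ^+ N.
  apply: real_geom_cauchy => N; apply: le_trans (h N).
  by apply: le_trans (Re_le_nm _); case: (u N) (u N.+1) => ? ? [].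
have [s Hs] : exists l, forall N, `|complex.Im (u N) - l| <= 2 * B * 2^-1 ^+ N.
  apply: real_geom_cauchy => N; apply: le_trans (h N).
  by apply: le_trans (Im_le_nm _); case: (u N) (u N.+1) => ? ? [].
exists (r +i* s) => N; apply: le_trans (nm_le_ReIm _) _.
have -> : 4 * B * 2^-1 ^+ N = 2 * B * 2^-1 ^+ N + 2 * B * 2^-1 ^+ N by ring.
by apply: lerD; [have := Hr N | have := Hs N]; case: (u N).
Qed.

Lemma geom_cauchy_series u (B : R) : (forall s, nm (u s) <= B * 2^-1 ^+ s) ->
  exists L, forall N, nm (\sum_(s < N) u s - L) <= 4 * B * 2^-1 ^+ N.
Proof.
move=> h; apply: (@geom_cauchy (fun N => \sum_(s < N) u s)) => N /=.
by rewrite big_ord_recr /= addrAC subrr add0r.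
Qed.

Lemma clim_geom0 B u L : (forall N, nm (u N - L) <= B * 2^-1 ^+ N) -> clim u L.
Proof. by move=> h; apply: (@clim_geom 0 B) => N _; rewrite subn0. Qed.

End ComplexLimits.

(** * Coefficients of exponentials of polynomials *)

Section ExpCoefficients.
Variables (F : numFieldType) (n : nat) (P : pred 'I_n) (a : 'I_n -> nat).
Hypothesis a_gt0 : forall i, (0 < a i)%N.

Definition texp (m : nat) (x : F) (N : nat) : {poly F} :=
  \sum_(r < N) (x ^+ r / r`!%:R) *: 'X^(m * r).

Definition pexp (p : 'I_n -> F) (N : 'I_n -> nat) : {poly F} :=
  \prod_(i | P i) texp (a i) (p i) (N i).

(* Coefficient of T^s in prod_(i | P i) exp (p i T^(a i)), which truncation
   beyond order s does not change. *)
Definition ecoef (p : 'I_n -> F) (s : nat) : F := (pexp p (fun=> s.+1))`_s.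

Lemma texp_coef_stable m x s N N' : (0 < m)%N -> (s < N)%N -> (s < N')%N ->
  (texp m x N)`_s = (texp m x N')`_s.
Proof.
move=> m0; suff H j : (texp m x (s.+1 + j))`_s = (texp m x s.+1)`_s.
  by move=> /subnKC <- /subnKC <-; rewrite !H.
elim: j => [|j IH]; first by rewrite addn0.
rewrite addnS /texp big_ord_recr /= -/(texp m x _) coefD IH coefZ coefXn.
by rewrite (_ : (s == _) = false) ?mulr0 ?addr0 //; apply/eqP; nia.
Qed.

Lemma coefM_agree (q q' r r' : {poly F}) s :
  (forall j, (j <= s)%N -> q`_j = q'`_j) -> (forall j, (j <= s)%N -> r`_j = r'`_j) ->
  forall j, (j <= s)%N -> (q * r)`_j = (q' * r')`_j.
Proof.
move=> hq hr j js; rewrite !coefM; apply: eq_bigr => i _.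
by rewrite hq ?hr //; have := ltn_ord i; lia.
Qed.

Lemma pexp_coef p N s : (forall i, (s < N i)%N) -> (pexp p N)`_s = ecoef p s.
Proof.
move=> sN; rewrite /ecoef /pexp.
suff: forall j, (j <= s)%N -> (\prod_(i | P i) texp (a i) (p i) (N i))`_j =
   (\prod_(i | P i) texp (a i) (p i) s.+1)`_j by apply.
elim/big_ind2: _ => // [q q' r r'|i _ j js]; first exact: coefM_agree.
by apply: texp_coef_stable => //; apply: leq_ltn_trans js _.
Qed.

(** The equation q' = c q modulo T^M. It is additive in c under products, so identities between
    exponentials can be checked on truncated polynomials. *)
Definition log_deriv (M : nat) (c q : {poly F}) :=
  forall j, (j < M)%N -> (q^`())`_j = (c * q)`_j.

Lemma log_derivM M c q c' q' : log_deriv M c q -> log_deriv M c' q' ->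
  log_deriv M (c + c') (q * q').
Proof.
move=> h h' j jM; rewrite derivM mulrDl !coefD mulrA [c' * _]mulrCA.
congr (_ + _).
  by apply: (@coefM_agree _ _ _ _ j) => // i ij; apply: h; lia.
by apply: (@coefM_agree _ _ _ _ j) => // i ij; apply: h'; lia.
Qed.

Lemma log_deriv_texp M N m x : (0 < m)%N -> (M < N)%N ->
  log_deriv M ((m%:R * x) *: 'X^(m.-1)) (texp m x N).
Proof.
move=> m0; case: N => // N MN j jM.
have -> : (texp m x N.+1)^`() = (m%:R * x) *: 'X^(m.-1) * texp m x N.
  rewrite /texp big_ord_recl /= muln0 expr0 derivD derivZ derivC scaler0 add0r.
  rewrite raddf_sum mulr_sumr; apply: eq_bigr => r _ /=.
  rewrite derivZ derivXn -scalerAl -scalerAr -exprD.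
  rewrite -[_ *+ (m * _)]scaler_nat !scalerA /bump /= add1n.
  have -> : (m * r.+1).-1 = (m.-1 + m * r)%N by nia.
  congr (_ *: _); rewrite factS exprS !natrM.
  have f0 : r`!%:R != 0 :> F by rewrite pnatr_eq0 -lt0n fact_gt0.
  have r0 : r.+1%:R != 0 :> F by rewrite pnatr_eq0.
  by field; rewrite f0 addrC natr1.
(* Differentiation drops the top term of [texp]; multiplied by c it would enter only in degree m - 1
   + m N, which is above j. *)
rewrite [in RHS]/texp big_ord_recr /= mulrDr coefD -/(texp m x N).
rewrite -scalerAl -[in X in _ + X]scalerAl -scalerAr -exprD !coefZ coefXn.
by rewrite (_ : (j == _) = false) ?mulr0 ?addr0 //; apply/eqP; nia.
Qed.

Lemma log_deriv_pexp p M N : (forall i, (M < N i)%N) ->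
  log_deriv M (\sum_(i | P i) ((a i)%:R * p i) *: 'X^((a i).-1)) (pexp p N).
Proof.
move=> MN; rewrite /pexp; elim/big_ind2: _ => [|????|i _].
- by move=> j _; rewrite mul0r derivC.
- exact: log_derivM.
- exact: log_deriv_texp.
Qed.

(** Coefficient of T^(s-1) in q' = (sum a_i p_i T^(a_i - 1)) q. It gives the decay of [ecoef] and,
    later, the conjugation of the Euler recurrence. *)
Lemma ecoef_rec p s : s%:R * ecoef p s =
  \sum_(i | P i) (a i)%:R * p i * (if (a i <= s)%N then ecoef p (s - a i) else 0).
Proof.
case: s => [|s].
  rewrite mul0r big1 // => i _.
  by rewrite leqn0 (gtn_eqF (a_gt0 i)) mulr0.
have := @log_deriv_pexp p s.+1 (fun=> s.+2) (fun=> ltnSn _) s (ltnSn _).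
rewrite coef_deriv pexp_coef // mulr_natl => ->.
rewrite mulr_suml coef_sum; apply: eq_bigr => i _.
rewrite -scalerAl coefZ coefXnM; have := a_gt0 i; case: (a i) => // m _ /=.
rewrite ltnS subSS; case: ltnP => // ms.
by rewrite pexp_coef // => _; lia.
Qed.

Lemma ecoef0 p : ecoef p 0 = 1.
Proof.
rewrite /ecoef /pexp coef0_prod big1 // => i _.
by rewrite /texp big_ord1 muln0 !expr0 fact0 invr1 mulr1 scale1r coef1.
Qed.

(** The logarithmic derivatives for p and - p cancel, so the product of the two exponentials has
    zero derivative in the degrees considered. *)
Lemma ecoefV p s :
  \sum_(j < s.+1) ecoef p j * ecoef (fun i => - p i) (s - j) = (s == 0)%:R.
Proof.
case: s => [|s]; first by rewrite big_ord1 !ecoef0 mulr1.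
pose N (i : 'I_n) := s.+3.
have -> : \sum_(j < s.+2) ecoef p j * ecoef (fun i => - p i) (s.+1 - j) =
   (pexp p N * pexp (fun i => - p i) N)`_s.+1.
  rewrite coefM; apply: eq_bigr => i _; have := ltn_ord i => ?.
  by rewrite !pexp_coef // => ?; rewrite /N; lia.
have MN i : (s.+1 < N i)%N by rewrite /N.
have := log_derivM (log_deriv_pexp p MN) (log_deriv_pexp (fun i => - p i) MN).
move=> /(_ s (ltnSn _)); move: (pexp p N * _) => q; rewrite -big_split /= big1 => [|i _]; last first.
  by rewrite -scalerDl mulrN subrr scale0r.
by rewrite mul0r coef0 coef_deriv => /eqP; rewrite mulrn_eq0 /= => /eqP.
Qed.

End ExpCoefficients.

(** * Majorants and decay of the exponential coefficients *)

Section ExpBounds.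
Variables (R : realType) (n : nat) (P : pred 'I_n) (a : 'I_n -> nat).
Hypothesis a_gt0 : forall i, (0 < a i)%N.

(** Triangle inequality against the exponential with coefficients |p_i|. As these majorants are
    nonnegative, raising the truncation only increases them, so the bound is uniform in N. *)
Lemma nm_pexp_coef (p : 'I_n -> R[i]) N s :
  nm (pexp P a p N)`_s <= ecoef P a (fun i => nm (p i)) s.
Proof.
rewrite -(@pexp_coef _ _ P a a_gt0 _ (fun i => maxn (N i) s.+1)); last first.
  by move=> i; rewrite leq_maxr.
pose K (q : {poly R[i]}) (Q : {poly R}) := forall s, nm q`_s <= Q`_s.
suff: K (pexp P a p N) (pexp P a (fun i => nm (p i)) (fun i => maxn (N i) s.+1)) by apply.
apply: (big_ind2 K) => [s'|q Q r S hq hr s'|i _ s'].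
- by rewrite !coef1; case: eqP; rewrite ?Normc.normc1 ?Normc.normc0.
- rewrite !coefM; apply: le_trans (nm_sum _ _ _) _; apply: ler_sum => j _.
  by rewrite Normc.normcM ler_pM ?nm_ge0.
- rewrite /texp !coef_sum; apply: le_trans (nm_sum _ _ _) _.
  set M := maxn _ _; have NM : (N i <= M)%N by exact: leq_maxl.
  rewrite -(subnKC NM) big_split_ord /= -[leLHS]addr0; apply: lerD.
    apply: ler_sum => r _; rewrite !coefZ !coefXn !Normc.normcM Normc.normcV nmX !nm_nat.
    exact: lexx.
  apply: sumr_ge0 => r _; rewrite coefZ coefXn !mulr_ge0 ?exprn_ge0 ?invr_ge0 ?nm_ge0 //.
Qed.

Lemma nm_ecoef (p : 'I_n -> R[i]) s :
  nm (ecoef P a p s) <= ecoef P a (fun i => nm (p i)) s.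
Proof. exact: nm_pexp_coef. Qed.

Lemma ecoef_ge0 (p : 'I_n -> R[i]) s : 0 <= ecoef P a (fun i => nm (p i)) s.
Proof. exact: le_trans (nm_ge0 _) (nm_ecoef _ _). Qed.

(** An exponential of a polynomial of degree < k has coefficients decaying faster than (s!)^(-1/k),
    by any geometric factor. Induction on s through [ecoef_rec], each shift being paid for by
    [mu_ratio]. *)
Lemma ecoef_bound (p : 'I_n -> R[i]) k (del : R) : (0 < k)%N ->
  (forall i, P i -> p i != 0 -> (a i < k)%N) -> 0 < del ->
  exists2 B, 0 <= B &
    forall s, ecoef P a (fun i => nm (p i)) s * mu R k s <= B * del ^+ s.
Proof.
move=> k0 ak d0; set e := ecoef _ _ _.
have e0 s : 0 <= e s by exact: ecoef_ge0.
have m0 := mu_gt0 R k.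
pose Q : R := \sum_(i | P i) (a i)%:R * nm (p i) * del ^- a i.
(* Q is the factor lost in one use of the recurrence, and from V on the root of s compensates it.
   The maximum with 1 excludes s = 0, whose root is 0. *)
have [V HV] := root_unbounded (Num.max Q 1) k0.
have ds m : 0 < del ^+ m by rewrite exprn_gt0.
have [B B0 HB] : exists2 B : R, 0 <= B & forall s, (s < V)%N -> e s * mu R k s <= B * del ^+ s.
  exists (\sum_(s < V) e s * mu R k s / del ^+ s) => [|s sV].
    by apply: sumr_ge0 => s _; rewrite !mulr_ge0 ?invr_ge0 ?exprn_ge0 ?mu_ge0 // ltW.
  rewrite -ler_pdivrMr // (bigD1 (Ordinal sV)) //= lerDl.
  by apply: sumr_ge0 => j _; rewrite !mulr_ge0 ?invr_ge0 ?exprn_ge0 ?mu_ge0 // ltW.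
exists B => // s; elim/ltn_ind: s => s IH.
case: (ltnP s V) => [/HB //|sV].
have := HV s sV; rewrite ge_max => /andP[Qr r1].
have r0 : 0 < root k (s%:R : R) by rewrite (lt_le_trans ltr01).
case: (posnP s) => [s0|s0].
  move: r1; rewrite s0 /root powR0 ?ler10 // invr_eq0 pnatr_eq0.
  by rewrite -lt0n.
have sR : 0 < s%:R :> R by rewrite ltr0n.
rewrite -(ler_pM2l sR) -(ler_pM2r r0) !mulrA (ecoef_rec P a_gt0).
apply: (@le_trans _ _ (\sum_(i | P i) (a i)%:R * nm (p i) * (B * del ^+ s * del ^- a i * s%:R))).
  rewrite !mulr_suml; apply: ler_sum => i Pi.
  case: ifP => ais; last first.
    by rewrite mulr0 !mul0r; do ![apply: mulr_ge0 => //]; rewrite ?nm_ge0 ?invr_ge0 ?(ltW (ds _)).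
  have [->|pi0] := eqVneq (p i) 0; first by rewrite Normc.normc0 mulr0 !mul0r.
  rewrite -!mulrA ler_wpM2l // ler_wpM2l ?nm_ge0 // -/e.
  have := mu_ratio R (s - a i) (ak i Pi pi0); rewrite subnK // => hr.
  have sai : (s - a i < s)%N by have := a_gt0 i; lia.
  have {IH sai} IH := IH _ sai.
  apply: le_trans (ler_wpM2l (e0 _) hr) _.
  rewrite [leLHS]mulrA; apply: (@le_trans _ _ (B * del ^+ (s - a i) * s%:R)).
    by rewrite ler_wpM2r // ltW.
  by rewrite !mulrA ler_wpM2r ?(ltW sR) // -[leRHS]mulrA -exprB ?unitfE ?gt_eqF.
have -> : \sum_(i | P i) (a i)%:R * nm (p i) * (B * del ^+ s * del ^- a i * s%:R) =
   s%:R * B * del ^+ s * Q.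
  by rewrite /Q mulr_sumr; apply: eq_bigr => i _; ring.
by rewrite ler_wpM2l // !mulr_ge0 // ltW.
Qed.

End ExpBounds.

(** * Sequences growing at most like (w!)^(1/c) times a geometric factor *)

Section Growth.
Variable R : realType.
Notation C := R[i].

Definition grow (c : nat) (d : nat -> C) := exists B K : R,
  [/\ 0 <= B, 1 <= K & forall w, nm (d w) <= B * K ^+ w * mu R c w].

Lemma growD c d d' : grow c d -> grow c d' -> grow c (fun w => d w + d' w).
Proof.
move=> [B [K [B0 K1 h]]] [B' [K' [B'0 K'1 h']]].
have K0 := le_trans ler01 K1; have K'0 := le_trans ler01 K'1.
exists (B + B'), (K * K'); split => [||w]; first exact: addr_ge0.
  by rewrite -[1]mulr1 ler_pM.
apply: le_trans (nmD _ _) _; rewrite -mulrA mulrDl.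
apply: lerD; [apply: le_trans (h w) _ | apply: le_trans (h' w) _];
  rewrite -mulrA ler_wpM2l // ler_wpM2r ?mu_ge0 // exprMn.
  by rewrite ler_peMr ?exprn_ge0 ?exprn_ege1.
by rewrite ler_peMl ?exprn_ge0 ?exprn_ege1.
Qed.

Lemma growZ c (x : C) d : grow c d -> grow c (fun w => x * d w).
Proof.
move=> [B [K [B0 K1 h]]]; exists (nm x * B), K; split => // [|w].
  by rewrite mulr_ge0 ?nm_ge0.
by rewrite Normc.normcM -!mulrA ler_wpM2l ?nm_ge0 // mulrA.
Qed.

Lemma grow_ext c d d' : (forall w, d w = d' w) -> grow c d -> grow c d'.
Proof. by move=> /funext ->. Qed.

Lemma grow0 c : grow c (fun=> 0).
Proof.
exists 0, 1; split => // w; by rewrite Normc.normc0 !mul0r.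
Qed.

Lemma grow_sum c (I : Type) (r : seq I) (d : I -> nat -> C) :
  (forall i, grow c (d i)) -> grow c (fun w => \sum_(i <- r) d i w).
Proof.
move=> h; elim: r => [|i r IH].
  by apply: grow_ext (grow0 c) => w; rewrite big_nil.
by apply: grow_ext (growD (h i) IH) => w; rewrite big_cons.
Qed.

Lemma grow_tail c M (d : nat -> C) (B K : R) : 0 <= B -> 1 <= K ->
  (forall w, (M <= w)%N -> nm (d w) <= B * K ^+ w * mu R c w) -> grow c d.
Proof.
move=> B0 K1 h; have K0 := le_trans ler01 K1.
exists (B + \sum_(j < M) nm (d j)), K.
have S0 : 0 <= \sum_(j < M) nm (d j) by apply: sumr_ge0 => *; exact: nm_ge0.
split => // [|w]; first exact: addr_ge0.
rewrite -mulrA mulrDl; have [wM|/h] := ltnP w M; last first.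
  move=> hw; rewrite mulrA; apply: le_trans hw _.
  by rewrite lerDl mulr_ge0 // mulr_ge0 ?exprn_ge0 ?mu_ge0.
have m1 : 1 <= K ^+ w * mu R c w by rewrite -[1]mulr1 ler_pM ?exprn_ege1 ?mu_ge1.
apply: (@le_trans _ _ (\sum_(j < M) nm (d j))).
  by rewrite (bigD1 (Ordinal wM)) //= lerDl; apply: sumr_ge0 => *; exact: nm_ge0.
apply: (@le_trans _ _ ((\sum_(j < M) nm (d j)) * (K ^+ w * mu R c w))).
  by rewrite ler_peMr.
by rewrite lerDr mulr_ge0 // (le_trans ler01).
Qed.

Lemma grow_eq_tail c M d d' : (forall w, (M <= w)%N -> d w = d' w) -> grow c d -> grow c d'.
Proof.
move=> e [B [K [B0 K1 h]]]; apply: (@grow_tail c M d' B K) => // w Mw.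
by rewrite -e.
Qed.

Lemma geom_half_sum N : \sum_(s < N) (2^-1 : R) ^+ s <= 2.
Proof.
suff -> : \sum_(s < N) (2^-1 : R) ^+ s = 2 - 2 * 2^-1 ^+ N.
  by rewrite lerBlDr lerDl mulr_ge0 ?exprn_ge0 ?invr_ge0.
elim: N => [|N IH]; first by rewrite big_ord0 expr0; lra.
by rewrite big_ord_recr /= IH exprS; field.
Qed.

End Growth.

(** * The operator exp (sum p_i T^(a_i)) on sequences *)

Section Transform.
Variables (R : realType) (n : nat) (P : pred 'I_n) (a : 'I_n -> nat).
Hypothesis a_gt0 : forall i, (0 < a i)%N.
Notation C := R[i].
Variables (p : 'I_n -> C) (k : nat).
Hypothesis k_gt0 : (0 < k)%N.
Hypothesis a_lt_k : forall i, P i -> p i != 0 -> (a i < k)%N.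
Local Notation e := (ecoef P a p).
Local Notation en := (ecoef P a (fun i => nm (p i))).

Definition etrans_part (d : nat -> C) (w N : nat) : C :=
  \sum_(s < N) e s * d (w + s)%N.

(* etrans d = exp (sum_(i | P i) p i T^(a i)) d, T being the shift. *)
Definition etrans (d : nat -> C) (w : nat) : C :=
  (limn (fun N => complex.Re (etrans_part d w N) : R)) +i*
  (limn (fun N => complex.Im (etrans_part d w N) : R)).

(** Two exponentials are estimated at once because the inverse transform is applied on top of the
    transform; t = 0 gives the single bound. *)
Lemma etrans_double_bound d : grow k d -> exists B K : R, [/\ 0 <= B, 1 <= K &
  forall w s t, en s * en t * nm (d (w + s + t)%N) <=
    B * K ^+ w * mu R k w * (4^-1 ^+ s * 4^-1 ^+ t)].
Proof.
move=> [B [K [B0 K1 h]]]; have K0 := lt_le_trans ltr01 K1.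
(* Splitting [mu] at w + s + t by [muD] twice costs (4 K)^s (4 K)^t, so decay at rate 1/(16 K)
   leaves 4^-s 4^-t. *)
have d0 : 0 < (16 * K)^-1 by rewrite invr_gt0 mulr_gt0.
have [D D0 hD] := ecoef_bound a_gt0 k_gt0 a_lt_k d0.
exists (B * D * D), (2 * K); split => [||w s t]; [by rewrite !mulr_ge0|lra|].
have eg s' : 0 <= en s' by exact: ecoef_ge0.
have K'0 m : 0 <= K ^+ m by rewrite exprn_ge0 // ltW.
have mg m : 0 <= mu R k m := mu_ge0 R k m.
have h1 : nm (d (w + s + t)%N) <=
   B * (2 * K) ^+ w * mu R k w * (4 * K) ^+ s * (4 * K) ^+ t * (mu R k s * mu R k t).
  apply: le_trans (h _) _.
  apply: (@le_trans _ _ (B * K ^+ (w + s + t) * (2 ^+ (w + s + t) *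
     (mu R k w * (2 ^+ (s + t) * (mu R k s * mu R k t)))))).
    rewrite ler_wpM2l ?mulr_ge0 // -addnA; apply: le_trans (muD _ _ _ _) _.
    by rewrite ler_wpM2l ?exprn_ge0 // ler_wpM2l // muD.
  rewrite le_eqVlt; apply/orP; left; apply/eqP.
  have -> : 4 = 2 * 2 :> R by ring.
  by rewrite !exprMn !exprD; ring.
apply: le_trans (ler_wpM2l (mulr_ge0 (eg s) (eg t)) h1) _.
apply: (@le_trans _ _ (B * (2 * K) ^+ w * mu R k w * (4 * K) ^+ s * (4 * K) ^+ t *
   ((en s * mu R k s) * (en t * mu R k t)))).
  by rewrite le_eqVlt; apply/orP; left; apply/eqP; ring.
apply: (@le_trans _ _ (B * (2 * K) ^+ w * mu R k w * (4 * K) ^+ s * (4 * K) ^+ t *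
   ((D * (16 * K)^-1 ^+ s) * (D * (16 * K)^-1 ^+ t)))).
  apply: ler_wpM2l; last by rewrite ler_pM ?mulr_ge0.
  have K40 m : 0 <= (4 * K) ^+ m by rewrite exprn_ge0 // mulr_ge0 // ltW.
  have K20 m : 0 <= (2 * K) ^+ m by rewrite exprn_ge0 // mulr_ge0 // ltW.
  by rewrite !mulr_ge0.
have E m : (4 * K) ^+ m * (16 * K)^-1 ^+ m = 4^-1 ^+ m :> R.
  by rewrite -exprMn; congr (_ ^+ _); field; rewrite gt_eqF.
rewrite -(E s) -(E t) le_eqVlt; apply/orP; left; apply/eqP; ring.
Qed.

Lemma etrans_bound d : grow k d -> exists B K : R, [/\ 0 <= B, 1 <= K &
  forall w s, en s * nm (d (w + s)%N) <= B * K ^+ w * mu R k w * 4^-1 ^+ s].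
Proof.
move=> /etrans_double_bound[B [K [B0 K1 h]]]; exists B, K; split => // w s.
by have := h w s 0%N; rewrite ecoef0 // !mulr1 addn0.
Qed.

Lemma exprV4_le s : (4^-1 : R) ^+ s <= 2^-1 ^+ s.
Proof. by apply: lerXn2r; rewrite ?nnegrE ?invr_ge0 //; lra. Qed.

Lemma etrans_lim d w : grow k d -> clim (etrans_part d w) (etrans d w).
Proof.
move=> /etrans_bound[B [K [B0 K1 h]]].
have [|L hL] := @geom_cauchy_series R (fun s => e s * d (w + s)%N) (B * K ^+ w * mu R k w).
  move=> s; rewrite Normc.normcM; apply: le_trans (_ : en s * nm (d (w + s)%N) <= _).
    by rewrite ler_wpM2r ?nm_ge0 // nm_ecoef.
  apply: le_trans (h w s) _; rewrite ler_wpM2l ?exprV4_le //.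
  by rewrite !mulr_ge0 ?exprn_ge0 ?mu_ge0 // (le_trans ler01).
have cL : clim (etrans_part d w) L by apply: clim_geom0 hL.
by rewrite /etrans (clim_lim cL).
Qed.

Lemma etrans_eq d w L : clim (etrans_part d w) L -> etrans d w = L.
Proof. by move=> h; rewrite /etrans (clim_lim h). Qed.

Lemma grow_etrans d : grow k d -> grow k (etrans d).
Proof.
move=> gd; have [B [K [B0 K1 h]]] := etrans_bound gd.
exists (B * 2), K; split => // [|w]; first by rewrite mulr_ge0.
apply: clim_le (etrans_lim w gd) _ => N.
apply: le_trans (nm_sum _ _ _) _.
apply: (@le_trans _ _ (\sum_(s < N) (B * K ^+ w * mu R k w) * 2^-1 ^+ s)).
  apply: ler_sum => s _; rewrite Normc.normcM.
  apply: le_trans (_ : en s * nm (d (w + s)%N) <= _).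
    by rewrite ler_wpM2r ?nm_ge0 // nm_ecoef.
  apply: le_trans (h w s) _; rewrite ler_wpM2l ?exprV4_le //.
  by rewrite !mulr_ge0 ?exprn_ge0 ?mu_ge0 // (le_trans ler01).
rewrite -mulr_sumr.
have -> : B * 2 * K ^+ w * mu R k w = B * K ^+ w * mu R k w * 2 by ring.
rewrite ler_wpM2l ?geom_half_sum //.
by rewrite !mulr_ge0 ?exprn_ge0 ?mu_ge0 // (le_trans ler01).
Qed.

Lemma etrans_finsupp V d : (forall v, (V <= v)%N -> d v = 0) ->
  forall w, (V <= w)%N -> etrans d w = 0.
Proof.
move=> h w Vw; apply: etrans_eq; apply: clim_ext (clim_cst 0) => N.
by rewrite /etrans_part big1 // => s _; rewrite h ?mulr0 // (leq_trans Vw) ?leq_addr.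
Qed.

Lemma etrans_sum (m : nat) (c : 'I_m -> C) (d : 'I_m -> nat -> C) w :
  (forall j, grow k (d j)) ->
  etrans (fun v => \sum_j c j * d j v) w = \sum_j c j * etrans (d j) w.
Proof.
move=> gd; apply: etrans_eq.
apply: clim_ext (clim_sum (index_enum _) (P := predT) (fun j _ => climZ (c j) (etrans_lim w (gd j)))).
move=> N; rewrite /etrans_part; under eq_bigr do rewrite mulr_sumr.
rewrite exchange_big /=; apply: eq_bigr => s _.
by rewrite mulr_sumr; apply: eq_bigr => j _; rewrite mulrCA.
Qed.

(** [ecoef_rec] summed against d: the commutator of the exponential with multiplication by the
    index. *)
Lemma etrans_weighted d w : grow k d ->
  clim (fun N => \sum_(u < N) u%:R * e u * d (w + u)%N)
       (\sum_(i | P i) (a i)%:R * p i * etrans d (w + a i)).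
Proof.
move=> gd.
apply: clim_ext (clim_sum (index_enum _) (P := P) (fun i _ =>
  climZ ((a i)%:R * p i) (clim_subn (a i) (etrans_lim (w + a i) gd)))).
move=> N; under [RHS]eq_bigr do rewrite ecoef_rec // mulr_suml.
rewrite exchange_big /=; apply: eq_bigr => i _.
rewrite /etrans_part mulr_sumr; have [Na|aN] := ltnP N (a i).
  rewrite (_ : (N - a i = 0)%N); last by lia.
  rewrite big_ord0 big1 // => u _; rewrite ifF ?mulr0 ?mul0r //.
  by apply/negbTE; have := ltn_ord u; lia.
have [m ->] : exists m, N = (a i + m)%N by exists (N - a i)%N; rewrite subnKC.
rewrite addKn big_split_ord /= [X in _ = X + _]big1 ?add0r.
  apply: eq_bigr => s _; by rewrite leq_addr addKn addnA !mulrA.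
move=> u _; rewrite ifF ?mulr0 ?mul0r //.
by apply/negbTE; rewrite -ltnNge.
Qed.

(** Conjugation: moving the factor w through the exponential produces exactly the terms a_i p_i
    T^(a_i) with P i. Hence only the shift by m remains on the right, a two-term recurrence that can
    be solved explicitly. *)
Lemma etrans_rho (m : nat) (x beta : C) d w : grow k d ->
  \sum_(i | P i) (a i)%:R * p i * etrans d (w + a i) + x * etrans d (w + m)
     - (beta - w%:R) * etrans d w =
  etrans (fun v => x * d (v + m)%N - (beta - v%:R) * d v) w.
Proof.
move=> gd; apply/esym/etrans_eq.
apply: clim_ext (climD (climD (etrans_weighted w gd) (climZ x (etrans_lim (w + m) gd)))
   (climN (climZ (beta - w%:R) (etrans_lim w gd)))).
move=> N; rewrite /etrans_part !mulr_sumr -sumrN -!big_split /=.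
apply: eq_bigr => s _; rewrite (_ : w + m + s = w + s + m)%N; last by lia.
rewrite natrD; ring.
Qed.

Lemma sum_triangle (F : nat -> nat -> C) N :
  \sum_(t < N) \sum_(s < N - t) F t s = \sum_(u < N) \sum_(t < u.+1) F t (u - t)%N.
Proof.
elim: N => [|N IH]; first by rewrite !big_ord0.
rewrite [RHS]big_ord_recr /= -IH big_ord_recr /= subSnn big_ord1.
rewrite [X in _ = _ + X]big_ord_recr /= subnn addrA; congr (_ + _).
rewrite -big_split /=; apply: eq_bigr => t _.
rewrite subSn; last by apply: ltnW.
by rewrite big_ord_recr.
Qed.

(* Convolution with the coefficients of exp(- sum p_i T^(a i)) inverts [etrans]. *)
Lemma etrans_inj M d : grow k d -> (forall w, (M <= w)%N -> etrans d w = 0) ->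
  forall w, (M <= w)%N -> d w = 0.
Proof.
move=> gd x0 w Mw; have [B [K [B0 K1 h]]] := etrans_double_bound gd.
pose e' := ecoef P a (fun i => - p i).
pose D := B * K ^+ w * mu R k w.
have D0 : 0 <= D by rewrite !mulr_ge0 ?exprn_ge0 ?mu_ge0 // (le_trans ler01).
have nme' t : nm (e' t) <= en t.
  apply: le_trans (@nm_ecoef R n P a a_gt0 _ _) _.
  by rewrite (_ : (fun i => nm (- p i)) = fun i => nm (p i)) //; apply/funext => i; rewrite normcN.
have bt t s : nm (e' t * (e s * d (w + t + s)%N)) <= D * 4^-1 ^+ t * 2^-1 ^+ s.
  rewrite !Normc.normcM; apply: le_trans (_ : en t * en s * nm (d (w + t + s)%N) <= _).
    rewrite mulrA ler_wpM2r ?nm_ge0 // ler_pM ?nm_ge0 // nm_ecoef //.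
  apply: le_trans (h _ _ _) _; rewrite -/D mulrA ler_wpM2l ?exprV4_le //.
  by rewrite mulr_ge0 // exprn_ge0 // invr_ge0.
(* The full sum is [etrans d (w + t)], which vanishes since w + t >= M; a partial sum is therefore
   minus a geometric tail. *)
clearbody D; have tail t N : nm (e' t * etrans_part d (w + t) N) <= 4 * (D * 4^-1 ^+ t) * 2^-1 ^+ N.
  have [L hL] := geom_cauchy_series (bt t).
  have cL : clim (fun N => \sum_(s < N) e' t * (e s * d (w + t + s)%N)) L by apply: clim_geom0 hL.
  have cL' : clim (fun N => \sum_(s < N) e' t * (e s * d (w + t + s)%N)) 0.
    apply: (clim_ext (u := fun N => e' t * etrans_part d (w + t) N)).
      by move=> N'; rewrite mulr_sumr.
    have := climZ (e' t) (etrans_lim (w + t) gd).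
    by rewrite x0 ?mulr0 //; lia.
  by have := hL N; rewrite (clim_unique cL cL') subr0 -mulr_sumr.
have key N : nm (d w) <= 8 * D * 2^-1 ^+ N.+1.
  (* Summed over the triangle t + s <= N, the double sum collapses by [ecoefV] to its term of total
     shift 0. *)
  have -> : d w = \sum_(t < N.+1) e' t * etrans_part d (w + t) (N.+1 - t).
    under eq_bigr do rewrite mulr_sumr.
    rewrite (sum_triangle (fun t s => e' t * (e s * d (w + t + s)%N))) big_ord_recl big_ord1 subnn addn0.
    rewrite {1}/e' !ecoef0 // !mul1r addn0 big1 ?addr0 // => u _.
    transitivity ((\sum_(t < (lift ord0 u).+1) e' t * e (lift ord0 u - t)) * d (w + lift ord0 u)%N).
      rewrite mulr_suml; apply: eq_bigr => t _; rewrite mulrA; congr (_ * d _).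
      by have := ltn_ord t; lia.
    have -> : e = ecoef P a (fun i => - (fun i => - p i) i).
      by congr ecoef; apply/funext => i; rewrite opprK.
    by rewrite /e' ecoefV // lift0 mul0r.
  apply: le_trans (nm_sum _ _ _) _.
  apply: (@le_trans _ _ (\sum_(t < N.+1) (4 * D * 2^-1 ^+ N.+1) * 2^-1 ^+ t)).
    apply: ler_sum => t _; apply: le_trans (tail _ _) _.
    (* Of 4^-t = 2^-t 2^-t, one factor completes the tail to 2^-(N+1) and the other makes the sum
       over t bounded. *)
    have tN : (t <= N.+1)%N by apply: ltnW.
    have -> : (2^-1 : R) ^+ N.+1 = 2^-1 ^+ t * 2^-1 ^+ (N.+1 - t) by rewrite -exprD subnKC.
    have -> : 4^-1 = 2^-1 * 2^-1 :> R by field.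
    by rewrite exprMn le_eqVlt; apply/orP; left; apply/eqP; ring.
  rewrite -mulr_sumr; have := geom_half_sum R N.+1.
  have q0 : 0 <= 4 * D * 2^-1 ^+ N.+1 by rewrite !mulr_ge0 ?exprn_ge0 ?invr_ge0.
  by move=> /(ler_wpM2l q0) /le_trans; apply; lra.
apply/Normc.eq0_normc/eqP; rewrite eq_le nm_ge0 andbT.
apply/ler_addgt0Pl => eps eps0; rewrite addr0.
have c0 : 0 < 8 * D + 1 by rewrite ltr_wpDl // mulr_ge0.
have [N0 /(_ N0.+1 (leqnSn _))] := exprV2_small (divr_gt0 eps0 c0).
rewrite ltr_pdivlMr // => hN; apply: le_trans (key N0) _; apply: ltW; apply: le_lt_trans hN.
by rewrite mulrC ler_wpM2l ?exprn_ge0 ?invr_ge0 // lerDl.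
Qed.

End Transform.

(** * The Euler recurrence *)

Section EulerRecurrence.
Variables (R : realType) (n : nat) (a : 'I_n -> nat).
Notation C := R[i].
Variables (p : 'I_n -> C) (beta : C) (c : nat).

Definition rho (d : nat -> C) (w : nat) : C :=
  \sum_i (a i)%:R * p i * d (w + a i)%N - (beta - w%:R) * d w.

Hypothesis c_gt0 : (0 < c)%N.
Hypothesis a_lt_c : forall i, p i != 0 -> (a i < c)%N.

(** In the norm weighted by K^w [mu c w], the shifts are at most half of the diagonal term for large
    w: every shift that occurs is < c, so [mu_ratio] gains a root of w. *)
Lemma rho_contraction (K : R) : 1 <= K -> exists M : nat, forall w, (M <= w)%N ->
  0 < nm (beta - w%:R) /\
  \sum_i (a i)%:R * nm (p i) * (K ^+ (w + a i) * mu R c (w + a i)) <=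
    2^-1 * nm (beta - w%:R) * (K ^+ w * mu R c w).
Proof.
move=> K1; have K0 := lt_le_trans ltr01 K1.
have Kg m : 0 <= K ^+ m by rewrite exprn_ge0 // ltW.
have [Q Q0 eQ] : exists2 Q : R, 0 <= Q & Q = \sum_i (a i)%:R * nm (p i) * K ^+ a i.
  by exists (\sum_i (a i)%:R * nm (p i) * K ^+ a i) => //; apply: sumr_ge0 => i _;
    rewrite !mulr_ge0 ?nm_ge0.
(* The shifts contribute at most 2 Q w / root, and half of |beta - w| is at least w / 4: the root
   has to reach 8 Q. The extra 1 keeps it positive. *)
have [V HV] := root_unbounded (8 * Q + 1) c_gt0.
pose b := nm beta; have b0 : 0 <= b := nm_ge0 _.
(* w >= 2 |beta| + c gives both |beta - w| >= w / 2 and w + a_i <= 2 w. *)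
exists (maxn V ((Num.truncn (2 * b)).+1 + c)) => w; rewrite geq_max => /andP[Vw bw].
have r1 := HV w Vw.
have bwR : 2 * b + c%:R <= w%:R.
  apply: (@le_trans _ _ ((Num.truncn (2 * b)).+1%:R + c%:R)); last by rewrite -natrD ler_nat.
  by rewrite lerD2r ltW // truncnS_gt.
have hb : w%:R / 2 <= nm (beta - w%:R).
  have := nm_distD beta w%:R 0; rewrite !subr0 nm_nat nm_distC -/b.
  have : 0 <= c%:R :> R by []. lra.
have c1 : 1 <= c%:R :> R by rewrite ler1n.
have w0 : 0 < w%:R :> R by lra.
split; first by apply: lt_le_trans hb; rewrite divr_gt0.
have r0 : 0 < root c (w%:R : R) by lra.
apply: (@le_trans _ _ (Q * (2 * w%:R / root c w%:R) * (K ^+ w * mu R c w))).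
  rewrite eQ !mulr_suml; apply: ler_sum => i _.
  have [->|pi0] := eqVneq (p i) 0; first by rewrite Normc.normc0 mulr0 !mul0r.
  have -> : (a i)%:R * nm (p i) * K ^+ a i * (2 * w%:R / root c w%:R) * (K ^+ w * mu R c w)
    = (a i)%:R * nm (p i) * (K ^+ (w + a i) * (mu R c w * (2 * w%:R) / root c w%:R)).
    by rewrite exprD; ring.
  rewrite ler_wpM2l ?mulr_ge0 ?nm_ge0 // ler_wpM2l // ler_pdivlMr //.
  have ac := a_lt_c pi0.
  apply: le_trans (_ : mu R c w * (w + a i)%:R <= _).
    apply: le_trans (mu_ratio R w ac); rewrite ler_wpM2l ?mu_ge0 //.
    by apply: root_le => //; rewrite ler_nat leq_addr.
  rewrite ler_wpM2l ?mu_ge0 // natrD.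
  have : (a i)%:R <= c%:R :> R by rewrite ler_nat ltnW.
  lra.
rewrite ler_wpM2r ?mulr_ge0 ?mu_ge0 //.
apply: (@le_trans _ _ (w%:R / 4)); last by lra.
rewrite mulrA ler_pdivrMr //.
have -> : w%:R / 4 * root c w%:R = w%:R * (root c w%:R / 4) :> R by ring.
have -> : Q * (2 * w%:R) = w%:R * (2 * Q) :> R by ring.
by rewrite ler_wpM2l ?(ltW w0) //; lra.
Qed.

(** The recurrence expresses x w through larger weights only, so each use of the contraction halves
    the bound at all large w simultaneously. *)
Lemma rho_slow_kernel x M0 : grow c x ->
  (forall w, (M0 <= w)%N -> rho x w = 0) ->
  exists M, forall w, (M <= w)%N -> x w = 0.
Proof.
move=> [B [K [B0 K1 hx]]] rx; have K0 := lt_le_trans ltr01 K1.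
have [M1 H] := rho_contraction K1.
exists (maxn M0 M1) => w; rewrite geq_max => /andP[h0 h1].
have key l : forall w, (M0 <= w)%N -> (M1 <= w)%N ->
    nm (x w) <= B * 2^-1 ^+ l * (K ^+ w * mu R c w).
  elim: l => [|l IH] {h0 h1 w} w h0 h1; first by rewrite expr0 mulr1 mulrA.
  have [bw0 hc] := H w h1.
  rewrite -(ler_pM2l bw0) -Normc.normcM.
  have /eqP : rho x w = 0 by exact: rx.
  rewrite subr_eq0 => /eqP <-.
  apply: le_trans (nm_sum _ _ _) _.
  apply: (@le_trans _ _ (B * 2^-1 ^+ l *
     (\sum_i (a i)%:R * nm (p i) * (K ^+ (w + a i) * mu R c (w + a i))))).
    rewrite mulr_sumr; apply: ler_sum => i _.
    rewrite !Normc.normcM nm_nat mulrCA ler_wpM2l ?mulr_ge0 ?nm_ge0 //.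
    by apply: IH; rewrite (leq_trans _ (leq_addr _ _)).
  apply: le_trans (ler_wpM2l _ hc) _; first by rewrite mulr_ge0 // exprn_ge0 // invr_ge0.
  by rewrite exprS le_eqVlt; apply/orP; left; apply/eqP; ring.
apply/Normc.eq0_normc/eqP; rewrite eq_le nm_ge0 andbT.
apply/ler_addgt0Pl => eps eps0; rewrite addr0.
pose D := B * (K ^+ w * mu R c w) + 1.
have D0 : 0 < D by rewrite ltr_wpDl // !mulr_ge0 ?exprn_ge0 ?mu_ge0 // ltW.
have [l /(_ l (leqnn _))] := exprV2_small (divr_gt0 eps0 D0).
rewrite ltr_pdivlMr // => hl; apply: le_trans (key l w h0 h1) _; apply: ltW.
apply: le_lt_trans hl; rewrite [leLHS]mulrAC mulrC ler_wpM2l ?exprn_ge0 ?invr_ge0 //.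
by rewrite /D lerDl.
Qed.

Lemma rho_slow_solve eps : grow c eps ->
  exists d M, grow c d /\ forall w, (M <= w)%N -> rho d w = eps w.
Proof.
move=> [B [K [B0 K1 he]]]; have K0 := lt_le_trans ltr01 K1.
have [M0 H0] := rho_contraction K1.
pose wt w : R := K ^+ w * mu R c w.
have wt0 w : 0 <= wt w by rewrite mulr_ge0 ?exprn_ge0 ?mu_ge0 // ltW.
(* The second term ensures |beta - w| >= 1, so that dividing by it does not enlarge [eps]. *)
pose M := maxn M0 ((Num.truncn (nm beta)).+2).
have H w : (M <= w)%N -> 1 <= nm (beta - w%:R) /\
    \sum_i (a i)%:R * nm (p i) * wt (w + a i)%N <= 2^-1 * nm (beta - w%:R) * wt w.
  rewrite geq_max => /andP[/H0[_ ?] bw]; split=> //.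
  have := nm_distD beta w%:R 0; rewrite !subr0 nm_nat nm_distC.
  have := truncnS_gt (nm beta).
  have : (Num.truncn (nm beta)).+1%:R + 1 <= w%:R :> R by rewrite natr1 ler_nat.
  lra.
pose A (x : nat -> C) w := if (M <= w)%N then
  (\sum_i (a i)%:R * p i * x (w + a i)%N - eps w) / (beta - w%:R) else 0.
(* Picard iteration for d = (sum a_i p_i T^(a_i) d - eps) / (beta - w); consecutive iterates differ
   by at most B 2^-l in the weighted norm. *)
pose X l := iter l A (fun=> 0).
have XS l w : nm (X l.+1 w - X l w) <= B * 2^-1 ^+ l * wt w.
  elim: l w => [|l IH] w.
    rewrite /X /= subr0 expr0 mulr1 /A; case: ifP => [/H[b1 _]|_]; last first.
      by rewrite Normc.normc0 mulr_ge0.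
    rewrite big1 => [|i _]; last by rewrite mulr0.
    rewrite sub0r mulNr normcN Normc.normcM Normc.normcV ler_pdivrMr ?(lt_le_trans ltr01) //.
    apply: le_trans (he w) _; rewrite -mulrA; apply: ler_peMr => //.
    exact: mulr_ge0 B0 (wt0 w).
  rewrite /X !iterS -/(X l.+1) -/(X l) /A; case: ifP => [/H[b1 hc]|_]; last first.
    rewrite subrr Normc.normc0; apply: mulr_ge0 (wt0 w).
    by rewrite mulr_ge0 // exprn_ge0 // invr_ge0.
  have b0 : 0 < nm (beta - w%:R) by rewrite (lt_le_trans ltr01).
  rewrite -mulrBl Normc.normcM Normc.normcV ler_pdivrMr //.
  rewrite opprB addrA subrK -sumrB.
  apply: le_trans (nm_sum _ _ _) _.
  apply: (@le_trans _ _ (B * 2^-1 ^+ l * (\sum_i (a i)%:R * nm (p i) * wt (w + a i)%N))).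
    rewrite mulr_sumr; apply: ler_sum => i _.
    rewrite -mulrBr !Normc.normcM nm_nat [leRHS]mulrCA ler_wpM2l ?mulr_ge0 ?nm_ge0 //.
    exact: IH.
  apply: le_trans (ler_wpM2l _ hc) _; first by rewrite mulr_ge0 // exprn_ge0 // invr_ge0.
  by rewrite exprS le_eqVlt; apply/orP; left; apply/eqP; ring.
have /choice[d hd] w : exists L, forall l, nm (X l w - L) <= 4 * (B * wt w) * 2^-1 ^+ l.
  by apply: geom_cauchy => l; have := XS l w; rewrite mulrAC.
have cd w : clim (fun l => X l w) (d w) by apply: clim_geom0 (hd w).
exists d, M; split.
  exists (4 * B), K; split => // [|w]; first by rewrite mulr_ge0.
  have := hd w 0%N; rewrite expr0 mulr1 /X /= sub0r normcN => /le_trans; apply.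
  by rewrite !mulrA.
move=> w Mw; have [b1 _] := H w Mw.
have bw0 : beta - w%:R != 0.
  by apply/eqP => e; move: b1; rewrite e Normc.normc0 ler10.
have c1 : clim (fun l => (beta - w%:R) * X l.+1 w) (\sum_i (a i)%:R * p i * d (w + a i)%N - eps w).
  apply: clim_ext (climD (clim_sum (index_enum _) (P := predT) (fun i _ =>
     climZ ((a i)%:R * p i) (cd (w + a i)%N))) (clim_cst (- eps w))) => l.
  by rewrite /X iterS /A Mw mulrCA divff // mulr1.
have c2 : clim (fun l => (beta - w%:R) * X l.+1 w) ((beta - w%:R) * d w).
  apply: climZ => e /(cd w)[N0 HN]; exists N0 => N N0N; apply: HN; exact: leqW.
by rewrite /rho -(clim_unique c1 c2) opprB addrC subrK.
Qed.

End EulerRecurrence.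

(** * Taylor coefficients and convergence *)

Section MultiIndices.
Variable n : nat.
Implicit Types u v w : mindex n.

Definition madd u v : mindex n := [ffun i => u i + v i]%N.
Definition mdelta (j : 'I_n) : mindex n := [ffun i => nat_of_bool (i == j)].
Definition mzero : mindex n := [ffun=> 0%N].
Definition mfact u : nat := (\prod_i (u i)`!)%N.
Definition wgt (a : 'I_n -> nat) u : nat := (\sum_i a i * u i)%N.

Lemma maddA u v w : madd u (madd v w) = madd (madd u v) w.
Proof. by apply/ffunP => i; rewrite !ffunE addnA. Qed.

Lemma maddC u v : madd u v = madd v u.
Proof. by apply/ffunP => i; rewrite !ffunE addnC. Qed.

Lemma madd0 u : madd u mzero = u.
Proof. by apply/ffunP => i; rewrite !ffunE addn0. Qed.

Lemma mdegD u v : mdeg (madd u v) = (mdeg u + mdeg v)%N.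
Proof. by rewrite /mdeg -big_split; apply: eq_bigr => i _; rewrite ffunE. Qed.

Lemma wgtD a u v : wgt a (madd u v) = (wgt a u + wgt a v)%N.
Proof. by rewrite /wgt -big_split; apply: eq_bigr => i _; rewrite ffunE mulnDr. Qed.

Lemma mdeg_delta j : mdeg (mdelta j) = 1%N.
Proof.
rewrite /mdeg (bigD1 j) //= ffunE eqxx big1 // => i /negbTE ij.
by rewrite ffunE ij.
Qed.

Lemma wgt_delta a j : wgt a (mdelta j) = a j.
Proof.
rewrite /wgt (bigD1 j) //= ffunE eqxx muln1 big1 ?addn0 // => i /negbTE ij.
by rewrite ffunE ij muln0.
Qed.

Lemma wgt0 a : wgt a mzero = 0%N.
Proof. by rewrite /wgt big1 // => i _; rewrite ffunE muln0. Qed.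

Lemma leq_mdeg u j : (u j <= mdeg u)%N.
Proof. by rewrite /mdeg (bigD1 j) //= leq_addr. Qed.

Lemma mfact_gt0 u : (0 < mfact u)%N.
Proof. by rewrite prodn_gt0 // => i; exact: fact_gt0. Qed.

Lemma mfact_delta u j : mfact (madd u (mdelta j)) = ((u j).+1 * mfact u)%N.
Proof.
rewrite /mfact (bigD1 j) //= [in RHS](bigD1 j) //= !ffunE eqxx addn1 factS mulnA.
congr (_ * _)%N; apply: eq_bigr => i /negbTE ij; by rewrite !ffunE ij addn0.
Qed.

Lemma mfact_le_deg u : (mfact u <= (mdeg u)`!)%N.
Proof.
rewrite /mfact /mdeg; elim/big_rec2: _ => // i x y _ h.
apply: leq_trans (leq_mul (leqnn _) h) _.
by rewrite -(bin_fact (leq_addr x (u i))) addKn leq_pmull // bin_gt0 leq_addr.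
Qed.

Lemma deg_fact_le u : ((mdeg u)`! <= 2 ^ (n * mdeg u) * mfact u)%N.
Proof.
suff H (r : seq 'I_n) : (\sum_(i <- r) u i <= mdeg u)%N ->
  ((\sum_(i <- r) u i)`! <= 2 ^ (size r * mdeg u) * \prod_(i <- r) (u i)`!)%N.
  have := H (index_enum 'I_n) (leqnn _).
  by rewrite (_ : size _ = n) // -sum1_size sum1_card card_ord.
elim: r => [|i r IH]; first by rewrite !big_nil.
rewrite !big_cons => h; apply: leq_trans (fact_add_le _ _) _.
have {}IH := IH (leq_trans (leq_addl _ _) h).
rewrite /= mulSn [X in (_ <= X * _)%N]expnD -[leqRHS]mulnA; apply: leq_mul; first by rewrite leq_exp2l.
by rewrite [leqRHS]mulnCA leq_mul2l IH orbT.
Qed.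

End MultiIndices.

(** * Convergence as a geometric bound on coefficients *)

Section Convergence.
Variables (R : realType) (n : nat).
Notation C := R[i].
Implicit Types (f g : fps R n) (al : mindex n).

Definition cbound f := exists B K : R,
  [/\ 0 <= B, 1 <= K & forall al, nm (f al) <= B * K ^+ mdeg al].

Lemma sum_box_le (s : seq (mindex n)) : uniq s ->
  \sum_(al <- s) (2^-1 : R) ^+ mdeg al <= 2 ^+ n.
Proof.
move=> us; pose N := (\max_(al <- s) mdeg al).+1.
pose h (m : {ffun 'I_n -> 'I_N}) : mindex n := [ffun i => nat_of_ord (m i)].
have g0 al : 0 <= (2^-1 : R) ^+ mdeg al by rewrite exprn_ge0 // invr_ge0.
apply: (@le_trans _ _ (\sum_(m : {ffun 'I_n -> 'I_N}) (2^-1 : R) ^+ mdeg (h m))).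
  apply: (@le_trans _ _ (\sum_(al <- s) \sum_(m | h m == al) (2^-1 : R) ^+ mdeg (h m))).
    rewrite !big_seq; apply: ler_sum => al als.
    have lt i : (al i < N)%N.
      by rewrite ltnS; apply: leq_trans (leq_mdeg al i) _; rewrite (big_rem al) //= leq_maxl.
    have hm : h [ffun i => Ordinal (lt i)] = al by apply/ffunP => i; rewrite !ffunE.
    rewrite (bigD1 [ffun i => Ordinal (lt i)]) ?hm //= lerDl.
    exact: sumr_ge0.
  under eq_bigr do rewrite big_mkcond.
  rewrite exchange_big /=; apply: ler_sum => m _.
  rewrite -big_mkcond /= (eq_bigl (pred1 (h m))) => [|al]; last by rewrite /= eq_sym.
  rewrite big_const_seq iter_addr_0 -[leRHS]mulr1n.
  by rewrite ler_wpMn2l // count_uniq_mem // leq_b1.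
have -> : \sum_(m : {ffun 'I_n -> 'I_N}) (2^-1 : R) ^+ mdeg (h m) =
    \prod_(i < n) \sum_(x < N) (2^-1 : R) ^+ x.
  rewrite bigA_distr_bigA /=; apply: eq_bigr => m _.
  by rewrite -prodrXr; apply: eq_bigr => i _; rewrite ffunE.
apply: (@le_trans _ _ (\prod_(i < n) 2)); last by rewrite prodr_const card_ord.
apply: ler_prod => i _; rewrite geom_half_sum andbT.
by apply: sumr_ge0 => x _; rewrite exprn_ge0 // invr_ge0.
Qed.

Lemma esum_geom (S : set (mindex n)) f (B K : R) : 0 <= B -> 1 <= K ->
  (forall al, S al -> nm (f al) <= B * K ^+ mdeg al) ->
  (\esum_(al in S) (nm (f al) * (2 * K)^-1 ^+ mdeg al)%:E < +oo)%E.
Proof.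
move=> B0 K1 h; have K0 := lt_le_trans ltr01 K1.
apply: (@le_lt_trans _ _ (B * 2 ^+ n)%:E); last exact: ltry.
apply: ge_ereal_sup => _ [X [finX XS] <-].
rewrite fsbig_finite //= sumEFin lee_fin.
have sX al : al \in finmap.enum_fset (fset_set X) -> X al.
  by move=> alX; apply/set_mem; rewrite -(in_fset_set finX al).
have us := finmap.fset_uniq (fset_set X).
move: sX us; set s := finmap.enum_fset _ => sX us.
apply: (@le_trans _ _ (\sum_(al <- s) B * 2^-1 ^+ mdeg al)).
  rewrite !big_seq; apply: ler_sum => al /sX /XS /h hal.
  rewrite invfM exprMn mulrCA [leRHS]mulrC ler_wpM2l ?exprn_ge0 ?invr_ge0 //.
  by rewrite exprVn ler_pdivrMr // exprn_gt0.
by rewrite -mulr_sumr ler_wpM2l // sum_box_le.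
Qed.

(** One way, a term is at most the whole sum; the other way, at radius 1/(2 K) the series is
    dominated by a geometric one of sum at most B 2^n. *)
Lemma convergentP f : convergent f <-> cbound f.
Proof.
split=> [[r r0 h]|[B [K [B0 K1 h]]]]; last first.
  exists (2 * K)^-1; last by apply: (esum_geom B0 K1) => al _; exact: h.
  by rewrite invr_gt0 mulr_gt0 // (lt_le_trans ltr01).
set e := esum _ _ in h.
have t0 al : 0 <= nm (f al) * r ^+ mdeg al by rewrite mulr_ge0 ?nm_ge0 // exprn_ge0 // ltW.
have e0 : (0 <= e)%E by apply: esum_ge0 => al _; rewrite lee_fin.
have efin : e \is a fin_num by rewrite ge0_fin_numE.
exists (fine e), (Num.max 1 r^-1); split; [exact: fine_ge0|by rewrite le_max lexx|].
move=> al.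
have hal : nm (f al) * r ^+ mdeg al <= fine e.
  rewrite -lee_fin fineK //; apply: esum_ge; exists [set al]; last by rewrite fsbig_set1.
  by split.
apply: (@le_trans _ _ (fine e * r^-1 ^+ mdeg al)).
  by rewrite exprVn ler_pdivlMr // exprn_gt0.
by rewrite ler_wpM2l ?fine_ge0 // lerXn2r ?nnegrE ?le_max ?ler01 ?invr_ge0 ?lexx ?orbT ?(ltW r0).
Qed.

Lemma cboundD f g : cbound f -> cbound g -> cbound (fun al => f al + g al).
Proof.
move=> [B [K [B0 K1 h]]] [B' [K' [B'0 K'1 h']]].
have K0 := le_trans ler01 K1; have K'0 := le_trans ler01 K'1.
exists (B + B'), (K * K'); split => [||al]; first exact: addr_ge0.
  by rewrite -[1]mulr1 ler_pM.
apply: le_trans (nmD _ _) _; rewrite mulrDl exprMn.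
apply: lerD; [apply: le_trans (h al) _ | apply: le_trans (h' al) _]; rewrite ler_wpM2l //.
  by rewrite ler_peMr ?exprn_ge0 ?exprn_ege1.
by rewrite ler_peMl ?exprn_ge0 ?exprn_ege1.
Qed.

Lemma cboundZ (c : C) f : cbound f -> cbound (fun al => c * f al).
Proof.
move=> [B [K [B0 K1 h]]]; exists (nm c * B), K; split => // [|al].
  by rewrite mulr_ge0 ?nm_ge0.
by rewrite Normc.normcM -mulrA ler_wpM2l ?nm_ge0.
Qed.

Lemma cbound0 : cbound (fun=> 0).
Proof. by exists 0, 1; split=> // al; rewrite Normc.normc0 mul0r. Qed.

Lemma cbound_ext f g : (forall al, f al = g al) -> cbound f -> cbound g.
Proof. by move=> /funext ->. Qed.

Lemma cboundB f g : cbound f -> cbound g -> cbound (fun al => f al - g al).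
Proof.
move=> hf /(cboundZ (-1)) hg; apply: cbound_ext (cboundD hf hg) => al.
by rewrite mulN1r.
Qed.

Lemma cbound_sum (I : Type) (r : seq I) (F : I -> fps R n) :
  (forall i, cbound (F i)) -> cbound (fun al => \sum_(i <- r) F i al).
Proof.
move=> h; elim: r => [|i r IH].
  by apply: cbound_ext cbound0 => w; rewrite big_nil.
by apply: cbound_ext (cboundD (h i) IH) => w; rewrite big_cons.
Qed.

Lemma cbound_opD j f : cbound f -> cbound (opD j f).
Proof.
move=> [B [K [B0 K1 h]]]; have K0 := le_trans ler01 K1.
exists (B * K), (2 * K); split => [||al]; [exact: mulr_ge0|lra|].
rewrite /opD Normc.normcM nm_nat.
have -> : [ffun i => al i + (i == j)]%N = madd al (mdelta j).
  by apply/ffunP => i; rewrite !ffunE.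
apply: le_trans (ler_wpM2l _ (h _)) _ => //; rewrite mdegD mdeg_delta addn1.
have -> : B * K * (2 * K) ^+ mdeg al = 2 ^+ mdeg al * (B * K ^+ (mdeg al).+1).
  by rewrite exprMn exprS; ring.
rewrite ler_wpM2r ?mulr_ge0 ?exprn_ge0 // -natrX ler_nat.
by apply: (@leq_trans (2 ^ al j)); [exact: ltn_expl | rewrite leq_exp2l // leq_mdeg].
Qed.

Lemma cbound_opX (p : 'rV[C]_n) j f : cbound f -> cbound (opX p j f).
Proof.
move=> hf; apply: cboundD; first exact: cboundZ.
move: hf => [B [K [B0 K1 h]]]; exists B, K; split=> // al.
have K0 := le_trans ler01 K1.
case: ifP => _; last by rewrite Normc.normc0 mulr_ge0 // exprn_ge0.
apply: le_trans (h _) _; rewrite ler_wpM2l // ler_weXn2l //.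
by apply: leq_sum => i _; rewrite ffunE leq_subr.
Qed.

Lemma cbound_opD_mon u f : cbound f -> cbound (opD_mon u f).
Proof.
move=> hf; rewrite /opD_mon; elim: (enum 'I_n) => //= j s IH.
by elim: (u j) => //= m; exact: cbound_opD.
Qed.

(** On the coefficients al! f_al the operator d^u is the pure shift by u. *)
Lemma opD_monE u f al :
  opD_mon u f al = (mfact (madd al u))%:R / (mfact al)%:R * f (madd al u).
Proof.
have f0 v : (mfact v)%:R != 0 :> C by rewrite pnatr_eq0 -lt0n mfact_gt0.
have itE j m g be : iter m (opD j) g be =
    (mfact (madd be [ffun i => (i == j) * m]%N))%:R / (mfact be)%:R *
    g (madd be [ffun i => (i == j) * m]%N).
  elim: m be => [|m IH] be /=.
    rewrite (_ : [ffun i => _] = mzero n) ?madd0 ?divff ?mul1r //.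
    by apply/ffunP => i; rewrite !ffunE muln0.
  rewrite {1}/opD (_ : [ffun i => be i + (i == j)]%N = madd be (mdelta j)); last first.
    by apply/ffunP => i; rewrite !ffunE.
  rewrite IH mfact_delta -maddA (_ : madd (mdelta j) _ = [ffun i => (i == j) * m.+1]%N); last first.
    by apply/ffunP => i; rewrite !ffunE mulnS.
  rewrite natrM mulrA; congr (_ * _).
  have b0 : (be j).+1%:R != 0 :> C by rewrite pnatr_eq0.
  by field; rewrite f0 addrC natr1 b0.
have H (s : seq 'I_n) be : uniq s -> foldr (fun j g => iter (u j) (opD j) g) f s be =
    (mfact (madd be [ffun i => (i \in s) * u i]%N))%:R / (mfact be)%:R *
    f (madd be [ffun i => (i \in s) * u i]%N).
  elim: s be => [|j s IH] be /=.
    by move=> _; rewrite (_ : [ffun i => _] = mzero n) ?madd0 ?divff ?mul1r.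
  move=> /andP[js us]; rewrite itE IH // -maddA.
  have -> : madd [ffun i => ((i == j) * u j)%N] [ffun i => ((i \in s) * u i)%N] =
      [ffun i => ((i \in j :: s) * u i)%N].
    apply/ffunP => i; rewrite !ffunE inE; case: eqP => [->|_] /=.
      by rewrite (negbTE js) addn0.
    by rewrite mul0n.
  by rewrite mulrA; congr (_ * _); field; rewrite !f0.
rewrite /opD_mon H ?enum_uniq // (_ : [ffun i => _] = u) //.
by apply/ffunP => i; rewrite ffunE mem_enum mul1n.
Qed.

Lemma cbound_mfact f : cbound f -> exists B K : R, [/\ 0 <= B, 1 <= K &
  forall al, nm ((mfact al)%:R * f al) <= B * K ^+ mdeg al * (mdeg al)`!%:R].
Proof.
move=> [B [K [B0 K1 h]]]; exists B, K; split => // al.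
rewrite Normc.normcM nm_nat mulrC ler_pM ?nm_ge0 // ler_nat; exact: mfact_le_deg.
Qed.

Lemma mfact_cbound f (B K : R) : 0 <= B -> 1 <= K ->
  (forall al, nm ((mfact al)%:R * f al) <= B * K ^+ mdeg al * (mdeg al)`!%:R) ->
  cbound f.
Proof.
move=> B0 K1 h; have K0 := le_trans ler01 K1.
exists B, (K * 2 ^+ n); split => // [|al].
  by rewrite -[leLHS]mulr1 ler_pM ?exprn_ege1 ?ler1n.
have f0 : 0 < (mfact al)%:R :> R by rewrite ltr0n mfact_gt0.
rewrite -(ler_pM2l f0); have := h al; rewrite Normc.normcM nm_nat => /le_trans; apply.
rewrite exprMn mulrCA -mulrA ler_wpM2l // mulrCA ler_wpM2l ?exprn_ge0 //.
by rewrite -exprM -natrX -natrM ler_nat mulnC deg_fact_le.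
Qed.

End Convergence.

(** * Series depending on the weight only *)

Lemma gcd_combination (n c : nat) (a : 'I_n -> nat) : (0 < c)%N ->
  exists v : mindex n, wgt a v = \big[gcdn/0%N]_i a i %[mod c].
Proof.
move=> c0; elim/big_ind: _ => [|x y [u hu] [v hv]|i _].
- by exists (mzero n); rewrite wgt0.
- have [x0|x0] := posnP x; first by exists v; rewrite x0 gcd0n.
  case: (egcdnP y x0) => s t e _.
  (* Bezout subtracts t copies of v; modulo c the natural number c t - t plays the role of - t. *)
  exists [ffun i => s * u i + (c * t - t) * v i]%N.
  have -> : wgt a [ffun i => s * u i + (c * t - t) * v i]%N = (s * wgt a u + (c * t - t) * wgt a v)%N.
    by rewrite /wgt !big_distrr -big_split; apply: eq_bigr => i _; rewrite ffunE mulnDr !(mulnCA (a i)).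
  rewrite -modnDm -modnMmr hu modnMmr -(modnMmr (c * t - t)) hv modnMmr modnDm e.
  have -> : (t * y + gcdn x y + (c * t - t) * y = t * y * c + gcdn x y)%N.
    have h : (t * y <= c * (t * y))%N by rewrite leq_pmull.
    by rewrite mulnBl -mulnA; lia.
  by rewrite modnMDl.
- by exists (mdelta i); rewrite wgt_delta.
Qed.

Section WeightSeries.
Variables (R : realType) (n : nat) (a : 'I_n.+1 -> nat).
Notation C := R[i].
Implicit Types (d : nat -> C) (f : fps R n.+1) (al u v : mindex n.+1).

Definition wseries d : fps R n.+1 := fun al => d (wgt a al) / (mfact al)%:R.

Lemma mfact_neq0 al : (mfact al)%:R != 0 :> C.
Proof. by rewrite pnatr_eq0 -lt0n mfact_gt0. Qed.

Lemma opD_mon_wseries u d al :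
  opD_mon u (wseries d) al = d (wgt a al + wgt a u)%N / (mfact al)%:R.
Proof.
rewrite opD_monE /wseries wgtD.
by field; rewrite !mfact_neq0.
Qed.

Lemma opDE j f al : opD j f al = (al j).+1%:R * f (madd al (mdelta j)).
Proof. by rewrite /opD; congr (_ * f _); apply/ffunP => i; rewrite !ffunE. Qed.

Lemma opD_wseries j d al :
  opD j (wseries d) al = d (wgt a al + a j)%N / (mfact al)%:R.
Proof.
rewrite opDE /wseries wgtD wgt_delta mfact_delta natrM.
by field; rewrite mfact_neq0 addrC natr1 pnatr_eq0.
Qed.

Lemma euler_opE (p : 'rV[C]_n.+1) beta f al : euler_op a p beta f al =
  \sum_j (a j)%:R * (p 0 j * opD j f al) - (beta - (wgt a al)%:R) * f al.
Proof.
have XD j : opX p j (opD j f) al = p 0 j * opD j f al + (al j)%:R * f al.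
  rewrite /opX; congr (_ + _); case: posnP => [->|al0]; first by rewrite mul0r.
  rewrite opDE ffunE eqxx subn1 prednK //; congr (_ * f _).
  by apply/ffunP => i; rewrite !ffunE; case: eqP => [->|_]; rewrite ?subn0 ?addn0 // subn1 addn1 prednK.
rewrite [LHS](_ : _ = (\sum_j fscale (a j)%:R (opX p j (opD j f))) al - beta * f al) //.
rewrite fct_sumE mulrBl opprB addrA.
congr (_ - _); rewrite /fscale.
under eq_bigr do rewrite XD mulrDr.
rewrite big_split /=; congr (_ + _).
by rewrite /wgt natr_sum mulr_suml; apply: eq_bigr => j _; rewrite natrM mulrA.
Qed.

End WeightSeries.

(** * From toric equations to sequences indexed by the weight *)

Section Apery.
Variables (R : realType) (n : nat) (a : 'I_n.+1 -> nat).
Notation C := R[i].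
Notation c := (a ord_max).
Hypothesis a_gt0 : forall i, (0 < a i)%N.
Hypothesis a_le : forall i, (a i <= c)%N.
Hypothesis a_gcd : \big[gcdn/0%N]_i a i = 1%N.
Implicit Types (d : nat -> C) (f : fps R n.+1) (al u v : mindex n.+1).

Let c_gt0 : (0 < c)%N. Proof. exact: a_gt0. Qed.

Lemma wgt_le al : (wgt a al <= c * mdeg al)%N.
Proof. by rewrite /wgt /mdeg big_distrr /=; apply: leq_sum => i _; rewrite leq_mul2r a_le orbT. Qed.

(** A weight is at most c times the degree, so [mu] is at most |al|! up to a geometric factor, and
    |al|! is comparable to the denominator al!. *)
Lemma grow_wseries d : grow c d -> cbound (wseries a d).
Proof.
move=> [B [K [B0 K1 h]]]; have K0 := le_trans ler01 K1.
have c1 : 1 <= c%:R :> R by rewrite ler1n.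
apply: (@mfact_cbound _ _ _ B (K ^+ c * c%:R)) => // [|al].
  by rewrite -[leLHS]mulr1 ler_pM // exprn_ege1.
rewrite /wseries mulrC divfK ?mfact_neq0 //.
apply: le_trans (h _) _; rewrite -!mulrA ler_wpM2l // exprMn -exprM -mulrA.
rewrite ler_pM ?exprn_ge0 ?mu_ge0 //; first by rewrite ler_weXn2l // wgt_le.
by apply: mu_le_fact => //; exact: wgt_le.
Qed.

Lemma residue_reached (j : nat) : exists v, wgt a v = j %[mod c].
Proof.
have [v hv] := gcd_combination a c_gt0; exists [ffun i => j * v i]%N.
have -> : wgt a [ffun i => j * v i]%N = (j * wgt a v)%N.
  by rewrite /wgt big_distrr; apply: eq_bigr => i _; rewrite ffunE mulnCA.
by rewrite -modnMmr hv a_gcd modnMmr muln1.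
Qed.

(* The weights of the [U j] form the Apery set, with respect to c, of the
   semigroup generated by the a i. *)
Lemma apery_set : exists U : nat -> mindex n.+1,
  [/\ U 0%N = mzero _, forall j, wgt a (U j) = j %[mod c]
    & forall j v, wgt a v = j %[mod c] -> (wgt a (U j) <= wgt a v)%N].
Proof.
have H j : exists u, wgt a u = j %[mod c] /\
    forall v, wgt a v = j %[mod c] -> (wgt a u <= wgt a v)%N.
  pose Q w := `[< exists v, wgt a v = w /\ w = j %[mod c] >].
  have exQ : exists w, Q w.
    by have [v hv] := residue_reached j; exists (wgt a v); apply/asboolP; exists v.
  case: (ex_minnP exQ) => w /asboolP[u [uw hw]] hmin; exists u; rewrite uw; split=> // v hv.
  by apply: hmin; apply/asboolP; exists v.
have [U hU] := choice H; exists U; split=> [|j|j v]; [|by case: (hU j)|by case: (hU j) => _; apply].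
case: (hU 0%N) => _ /(_ (mzero _)); rewrite wgt0 => /(_ erefl).
rewrite leqn0 /wgt sum_nat_eq0 => /forallP h; apply/ffunP => i.
have := h i; rewrite muln_eq0 ffunE => /orP[|/eqP //].
by rewrite (gtn_eqF (a_gt0 i)).
Qed.

Definition lastm (m : nat) : mindex n.+1 := [ffun i => (i == ord_max) * m]%N.

Lemma lastm_sum (w : 'I_n.+1 -> nat) m : (\sum_i w i * lastm m i = w ord_max * m)%N.
Proof.
rewrite (bigD1 ord_max) //= ffunE eqxx mul1n big1 ?addn0 // => i /negbTE h.
by rewrite ffunE h mul0n muln0.
Qed.

Lemma wgt_lastm m : wgt a (lastm m) = (c * m)%N.
Proof. exact: lastm_sum. Qed.

Lemma mdeg_lastm m : mdeg (lastm m) = m.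
Proof.
rewrite -[RHS]mul1n -(lastm_sum (fun=> 1%N) m); apply: eq_bigr => i _; by rewrite mul1n.
Qed.

Lemma eqmod_leq_split x y : x = y %[mod c] -> (x <= y)%N -> (y = x + c * ((y - x) %/ c))%N.
Proof.
move=> e xy; rewrite [(c * _)%N]mulnC divnK ?subnKC //.
by rewrite -eqn_mod_dvd // e.
Qed.

(** Each large w is the weight of a multi-index of degree about w / c: the Apery element of its
    residue followed by letters [ord_max]. The Cauchy bound at that index is the growth bound for d
    w. *)
Lemma wseries_grow d : cbound (wseries a d) -> grow c d.
Proof.
move=> /cbound_mfact[B [K [B0 K1 h]]]; have K0 := le_trans ler01 K1.
have [U [U0 Um Umin]] := apery_set.
(* Bounds degrees and weights of all Apery elements, so weights from D on lie in the semigroup. *)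
pose D := (\sum_(j < c) (mdeg (U j) + wgt a (U j)))%N.
have hD j : (j < c)%N -> (mdeg (U j) + wgt a (U j) <= D)%N.
  by move=> jc; rewrite /D (bigD1 (Ordinal jc)) //= leq_addr.
apply: (@grow_tail _ c D d (B * K ^+ D * 2 ^+ D * D`!%:R) (K * 2)) => [||w Dw].
- by rewrite !mulr_ge0 ?exprn_ge0.
- lra.
pose j := (w %% c)%N; have jc : (j < c)%N by rewrite ltn_mod.
have hj := hD j jc.
have e : w = (wgt a (U j) + c * ((w - wgt a (U j)) %/ c))%N.
  by apply: eqmod_leq_split; [rewrite Um modn_mod | lia].
set m := ((w - _) %/ c)%N in e.
have mw : (m <= w)%N by rewrite e; have := c_gt0; nia.
have wE : wgt a (madd (U j) (lastm m)) = w by rewrite wgtD wgt_lastm -e.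
have := h (madd (U j) (lastm m)); rewrite /wseries mulrC divfK ?mfact_neq0 // wE.
have dm : (mdeg (madd (U j) (lastm m)) <= D + m)%N by rewrite mdegD mdeg_lastm; lia.
move=> /le_trans; apply.
apply: (@le_trans _ _ (B * K ^+ (D + m) * (2 ^ (D + m) * (D`! * m`!))%:R)).
  rewrite -!mulrA ler_wpM2l // ler_pM ?exprn_ge0 //; first by rewrite ler_weXn2l.
  by rewrite ler_nat; apply: leq_trans (fact_add_le _ _); apply: leq_fact.
apply: (@le_trans _ _ (B * K ^+ (D + m) * (2 ^ (D + m) * D`!)%:R * mu R c w)).
  rewrite mulnA natrM [leLHS]mulrA ler_wpM2l ?mulr_ge0 ?exprn_ge0 //.
  by apply: le_trans (mu_ge_fact R m c_gt0) _; apply: mu_le; rewrite e; lia.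
rewrite ler_wpM2r ?mu_ge0 // natrM natrX exprMn.
apply: (@le_trans _ _ (B * K ^+ (D + w) * (2 ^+ (D + w) * D`!%:R))).
  rewrite -!mulrA ler_wpM2l // ler_pM ?mulr_ge0 ?exprn_ge0 //.
    by rewrite ler_weXn2l // leq_add2l.
  by rewrite ler_wpM2r // ler_weXn2l ?ler1n // leq_add2l.
by rewrite !exprD le_eqVlt; apply/orP; left; apply/eqP; ring.
Qed.

Lemma uniform_cbound_mfact (I : finType) (F : I -> fps R n.+1) :
  (forall i, cbound (F i)) -> exists B K : R, [/\ 0 <= B, 1 <= K &
    forall i al, nm ((mfact al)%:R * F i al) <= B * K ^+ mdeg al * (mdeg al)`!%:R].
Proof.
move=> h; have /choice[B /choice[K hBK]] i := cbound_mfact (h i).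
exists (\sum_i B i), (1 + \sum_i K i).
have B0 i : 0 <= B i by case: (hBK i).
have K1 i : 1 <= K i by case: (hBK i).
have K0 i : 0 <= K i by rewrite (le_trans ler01).
split=> [||i al]; first exact: sumr_ge0.
  by rewrite lerDl sumr_ge0.
have [_ _ /(_ al) /le_trans] := hBK i; apply.
have SK : K i <= 1 + \sum_i K i.
  by rewrite (bigD1 i) //= addrCA lerDl addr_ge0 // sumr_ge0.
rewrite ler_wpM2r // ler_pM ?exprn_ge0 //.
  by rewrite (bigD1 i) //= lerDl sumr_ge0.
by rewrite lerXn2r ?nnegrE ?(le_trans (K0 i) SK).
Qed.

(* Modulo convergent series, the toric equations force al! f_al to depend on
   the weight of al only: each letter i < n+1 is traded for letters ord_max,
   the Apery element recording the remaining weight. *)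
Lemma toric_wseries f :
  (forall u v, wgt a u = wgt a v -> cbound (fun al => opD_mon u f al - opD_mon v f al)) ->
  exists d, cbound (fun al => f al - wseries a d al).
Proof.
move=> hT; have [U [U0 Um Umin]] := apery_set.
pose W j := wgt a (U j).
(* Trading rule: the Apery element j plus a letter i has the weight of the Apery element [nx j i]
   plus [lx j i] letters [ord_max]. *)
pose nx (j : nat) (i : 'I_n.+1) := ((W j + a i) %% c)%N.
pose lx (j : nat) (i : 'I_n.+1) := ((W j + a i - W (nx j i)) %/ c)%N.
have hx j i : (W j + a i = W (nx j i) + c * lx j i)%N.
  have e : (W (nx j i) = W j + a i %[mod c])%N by rewrite /W Um modn_mod.
  apply: eqmod_leq_split => //; rewrite -(wgt_delta a i) -wgtD; apply: Umin.
  by rewrite wgtD wgt_delta modn_mod.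
pose cf al := (mfact al)%:R * f al.
(* Only finitely many binomials express the trading rules, hence common constants B and K. *)
pose err (x : 'I_c * 'I_n.+1) : fps R n.+1 := fun al =>
  opD_mon (madd (U x.1) (mdelta x.2)) f al -
  opD_mon (madd (U (nx x.1 x.2)) (lastm (lx x.1 x.2))) f al.
have [|B [K [B0 K1 hE]]] := @uniform_cbound_mfact _ err.
  by move=> x; apply: hT; rewrite !wgtD wgt_delta wgt_lastm; exact: hx.
have K0 := le_trans ler01 K1.
have hE' j i al : (j < c)%N ->
    nm (cf (madd (U j) (madd (mdelta i) al)) - cf (madd (U (nx j i)) (madd (lastm (lx j i)) al)))
    <= B * K ^+ mdeg al * (mdeg al)`!%:R.
  move=> jc; have := hE (Ordinal jc, i) al; rewrite /err /= !opD_monE mulrBr.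
  rewrite !(maddC al) -!maddA [_%:R * (_ * _)]mulrA [_%:R * (_ / _)]mulrC divfK ?mfact_neq0 //.
  by rewrite [_%:R * (_ * _)]mulrA [_%:R * (_ / _)]mulrC divfK ?mfact_neq0.
(* The coefficient at the normal form of weight w. Outside the semigroup truncated subtraction
   yields a default value. *)
pose d w := cf (madd (U (w %% c)%N) (lastm ((w - W (w %% c)%N) %/ c))).
have nxc j i : (nx j i < c)%N by rewrite ltn_mod.
have dW j m : (j < c)%N -> d (W j + c * m)%N = cf (madd (U j) (lastm m)).
  move=> jc; rewrite /d.
  have -> : ((W j + c * m) %% c = j)%N by rewrite addnC mulnC modnMDl Um modn_small.
  by rewrite addKn mulKn.
(* m counts the letters other than [ord_max], one per trade. As a_i <= c, a trade never increases c
   |v| + W j, so T bounds the degree along the whole path and each trade costs at most B K^T T!. *)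
have path T m : forall j v, (j < c)%N -> (\sum_(i | i != ord_max) v i = m)%N ->
    (c * mdeg v + W j <= c * T)%N ->
    nm (cf (madd (U j) v) - d (W j + wgt a v)%N) <= m%:R * (B * K ^+ T * T`!%:R).
  elim: m => [|m IH] j v jc vm vT.
    have -> : v = lastm (v ord_max).
      apply/ffunP => i; rewrite ffunE; case: eqP => [->|/eqP ni]; first by rewrite mul1n.
      move/eqP: vm; rewrite mul0n sum_nat_eq0 => /forallP /(_ i) /implyP /(_ ni).
      by move/eqP.
    by rewrite wgt_lastm dW // subrr Normc.normc0 mul0r.
  have [i ni vi] : exists2 i, i != ord_max & (0 < v i)%N.
    apply: contrapT => hn; move: vm; rewrite big1 // => i ni.
    by apply/eqP; rewrite -leqn0 leqNgt; apply/negP => vi; apply: hn; exists i.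
  pose v1 : mindex n.+1 := [ffun i' => v i' - (i' == i)]%N.
  have v1E : v = madd (mdelta i) v1.
    apply/ffunP => i'; rewrite !ffunE; case: eqP => [->|_]; last by rewrite subn0.
    by rewrite subnKC.
  have dv : mdeg v = (mdeg v1).+1 by rewrite v1E mdegD mdeg_delta.
  have hxi := hx j i.
  have wv : (W j + wgt a v = W (nx j i) + wgt a (madd (lastm (lx j i)) v1))%N.
    by rewrite v1E !wgtD wgt_delta wgt_lastm; lia.
  have ai := a_le i.
  have mT : (mdeg v1 <= T)%N by move: vT; rewrite dv; have := c_gt0; nia.
  apply: le_trans (nm_distD (cf (madd (U (nx j i)) (madd (lastm (lx j i)) v1))) _ _) _.
  rewrite -natr1 mulrDl mul1r [leRHS]addrC; apply: lerD.
    rewrite [in X in cf X]v1E; apply: le_trans (hE' _ _ _ jc) _.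
    rewrite -!mulrA ler_wpM2l // ler_pM ?exprn_ge0 //; first by rewrite ler_weXn2l.
    by rewrite ler_nat leq_fact.
  rewrite wv; apply: IH => //.
    apply: succn_inj; rewrite -vm (bigD1 i) //= [in RHS](bigD1 i) //= -addSn.
    rewrite !ffunE (negbTE ni) mul0n add0n eqxx subn1 prednK //; congr (_ + _)%N.
    apply: eq_bigr => i' /andP[/negbTE n1 /negbTE n2].
    by rewrite !ffunE n1 n2 mul0n subn0.
  by move: vT; rewrite dv mdegD mdeg_lastm; nia.
exists d; apply: (@mfact_cbound _ _ _ B (2 * K)) => // [|al]; first lra.
have -> : (mfact al)%:R * (f al - wseries a d al) = cf (madd (U 0%N) al) - d (W 0%N + wgt a al)%N.
  rewrite U0 maddC madd0 /W U0 wgt0 add0n mulrBr; congr (_ - _).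
  by rewrite mulrC divfK ?mfact_neq0.
apply: le_trans (path (mdeg al) _ 0%N al c_gt0 erefl _) _.
  by rewrite /W U0 wgt0 addn0.
have -> : B * (2 * K) ^+ mdeg al * (mdeg al)`!%:R = 2 ^+ mdeg al * (B * K ^+ mdeg al * (mdeg al)`!%:R).
  by rewrite exprMn; ring.
rewrite ler_wpM2r ?mulr_ge0 ?exprn_ge0 // -natrX ler_nat.
apply: leq_trans (ltnW (ltn_expl (mdeg al) (ltnSn 1))).
by rewrite /mdeg [leqRHS](bigID (fun i => i != ord_max)) /= leq_addr.
Qed.

End Apery.

(** * Annihilation by the hypergeometric ideal modulo convergent series *)

Section Annihilation.
Variables (R : realType) (n : nat) (a : 'I_n.+1 -> nat).
Notation C := R[i].
Notation c := (a ord_max).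
Hypothesis a_gt0 : forall i, (0 < a i)%N.
Hypothesis a_le : forall i, (a i <= c)%N.
Hypothesis a_gcd : \big[gcdn/0%N]_i a i = 1%N.
Variables (p : 'rV[C]_n.+1) (beta : C).
Implicit Types (d : nat -> C) (f : fps R n.+1) (al u v : mindex n.+1).

Lemma subalg_cbound (G : set (oper R n.+1)) P f :
  (forall Q g, G Q -> cbound g -> cbound (Q g)) ->
  subalg G P -> cbound f -> cbound (P f).
Proof.
move=> hG hP; elim: hP f => {P} [P GP|x|P Q _ hP _ hQ|P Q _ hP _ hQ] f cf.
- exact: hG.
- exact: cboundZ.
- exact: (cboundD (hP _ cf) (hQ _ cf)).
- exact/hP/hQ.
Qed.

Lemma weyl_cbound P f : weyl p P -> cbound f -> cbound (P f).
Proof.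
apply: subalg_cbound => Q g [j [->|->]]; [exact: cbound_opX|exact: cbound_opD].
Qed.

Lemma diff_ops_cbound P f : @diff_ops R n.+1 P -> cbound f -> cbound (P f).
Proof. by apply: subalg_cbound => Q g [j ->]; exact: cbound_opD. Qed.

Lemma euler_opB f g al :
  euler_op a p beta (fun be => f be - g be) al =
  euler_op a p beta f al - euler_op a p beta g al.
Proof.
rewrite !euler_opE (_ : \sum_j _ = \sum_j (a j)%:R * (p 0 j * opD j f al) -
  \sum_j (a j)%:R * (p 0 j * opD j g al)); first by ring.
by rewrite -sumrB; apply: eq_bigr => j _; rewrite !opDE; ring.
Qed.

Lemma cbound_euler_op f : cbound f -> cbound (euler_op a p beta f).
Proof.
move=> cf; apply: (cbound_ext (f := fun al =>
  \sum_j (a j)%:R * opX p j (opD j f) al - beta * f al)).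
  by move=> al; rewrite /euler_op [RHS](_ : _ =
    (\sum_j fscale (a j)%:R (opX p j (opD j f))) al - beta * f al) // fct_sumE.
apply: cboundB; last exact: cboundZ.
apply: cbound_sum => j; apply: cboundZ; exact/cbound_opX/cbound_opD.
Qed.

Lemma euler_wseries d al : euler_op a p beta (wseries a d) al =
  wseries a (rho a (p 0) beta d) al.
Proof.
rewrite euler_opE /rho /wseries [RHS]mulrBl mulrA; congr (_ - _).
rewrite mulr_suml; apply: eq_bigr => j _.
by rewrite opD_wseries !mulrA.
Qed.

Lemma absz_max_sub (x y : nat) : absz (Num.max (Posz x - Posz y) 0) = (x - y)%N.
Proof.
by have [h|h] := leqP x y; [rewrite max_r|rewrite max_l]; lia.
Qed.

Lemma absz_pos_neg (x : int) : (absz (Num.max x 0))%:Z - (absz (Num.max (- x) 0))%:Z = x.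
Proof.
have [h|h] := lerP x 0.
  by rewrite max_l; lia.
by rewrite max_r; lia.
Qed.

Lemma pos_neg_parts u v (w := fun i => Posz (u i) - Posz (v i)) :
  exists x, [/\ madd x (pos_part w) = u & madd x (neg_part w) = v].
Proof.
exists [ffun i => minn (u i) (v i)].
by split; apply/ffunP => i; rewrite !ffunE /w ?opprB absz_max_sub; move: (u i) (v i) => *; lia.
Qed.

Lemma Posz_wgt u : (wgt a u)%:Z = \sum_i (a i)%:Z * (u i)%:Z.
Proof. by rewrite /wgt; elim/big_rec2: _ => // i y t _ <-; rewrite PoszD PoszM. Qed.

(** The ideal is generated by binomials of disjoint support; a general one is obtained by applying
    d^x, with x = min (u, v), which preserves convergence. *)
Lemma toric_binomial f u v :
  (forall P, toric_ideal a P -> convergent (P f)) -> wgt a u = wgt a v ->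
  cbound (fun al => opD_mon u f al - opD_mon v f al).
Proof.
move=> hf uv; have [x [xu xv]] := pos_neg_parts u v.
set w := fun i => _ in xu xv.
have aw : \sum_i (a i)%:Z * w i = 0.
  rewrite /w; under eq_bigr do rewrite mulrBr.
  by rewrite sumrB -!Posz_wgt uv subrr.
have /convergentP/(cbound_opD_mon x) : convergent (opD_mon (pos_part w) f - opD_mon (neg_part w) f).
  by apply: (hf (fun f => opD_mon (pos_part w) f - opD_mon (neg_part w) f));
    apply: left_ideal_gen; exists w.
apply: cbound_ext => al; rewrite opD_monE.
rewrite [X in _ * X](_ : _ = opD_mon (pos_part w) f (madd al x) - opD_mon (neg_part w) f (madd al x)) //.
rewrite mulrBr !opD_monE -!maddA xu xv.
by congr (_ - _); field; rewrite !mfact_neq0.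
Qed.

(** Weyl operators preserve convergence, so generators suffice. The binomials kill [wseries a d]
    exactly, and the Euler operator sends it to the series of [rho d], convergent iff [rho d] has
    growth c. *)
Lemma annihilatedP f : (forall P, hyper_ideal a p beta P -> convergent (P f)) <->
  exists d, cbound (fun al => f al - wseries a d al) /\ grow c (rho a (p 0) beta d).
Proof.
split=> [hf|[d [fd rd]]].
  have [|d fd] := toric_wseries a_gt0 a_le a_gcd (f := f).
    move=> u v; apply: toric_binomial => P hP; apply: hf.
    by apply: left_ideal_gen; left.
  exists d; split=> //; apply: wseries_grow => //.
  have /convergentP ef : convergent (euler_op a p beta f).
    by apply: hf; apply: left_ideal_gen; right.
  apply: cbound_ext (cboundB ef (cbound_euler_op fd)) => al.
  by rewrite euler_opB opprB addrC subrK euler_wseries.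
have hE : cbound (euler_op a p beta f).
  apply: cbound_ext (cboundD (cbound_euler_op fd) (grow_wseries a_gt0 a_le rd)) => al.
  by rewrite euler_opB -euler_wseries subrK.
have hT P : toric_ideal a P -> cbound (P f).
  elim=> {P} [P [u [au ->]]||P Q _ hP _ hQ|P Q BP _ hQ].
  - have e : wgt a (pos_part u) = wgt a (neg_part u).
      apply/eqP; rewrite -eqz_nat -subr_eq0 -[X in _ == X]au !Posz_wgt -sumrB.
      apply/eqP/eq_bigr => i _; by rewrite -mulrBr !ffunE absz_pos_neg.
    apply: cbound_ext (cboundB (cbound_opD_mon (pos_part u) fd) (cbound_opD_mon (neg_part u) fd)) => al.
    rewrite [RHS](_ : _ = opD_mon (pos_part u) f al - opD_mon (neg_part u) f al) //.
    have H (v : mindex n.+1) : opD_mon v (fun al => f al - wseries a d al) al =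
        opD_mon v f al - d (wgt a al + wgt a v)%N / (mfact al)%:R.
      by rewrite -opD_mon_wseries !opD_monE mulrBr.
    by rewrite !H e opprB addrA subrK.
  - exact: (cbound_ext (f := fun=> 0) (fun=> erefl) (@cbound0 R n.+1)).
  - exact: (cboundD hP hQ).
  - exact: (diff_ops_cbound BP hQ).
move=> P hP; apply/convergentP; elim: hP => {P} [P [/hT //|-> //]||P Q _ hP _ hQ|P Q BP _ hQ].
- exact: (cbound_ext (f := fun=> 0) (fun=> erefl) (@cbound0 R n.+1)).
- exact: (cboundD hP hQ).
- exact: (weyl_cbound BP hQ).
Qed.

End Annihilation.

(** * The Gevrey order c / k of series of growth k *)

Section GevreyBound.
Variables (R : realType) (n : nat) (a : 'I_n.+1 -> nat).
Notation C := R[i].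
Notation c := (a ord_max).
Hypothesis a_gt0 : forall i, (0 < a i)%N.
Variable k : nat.
Hypothesis k_gt0 : (0 < k)%N.
Hypothesis k_le : (k <= c)%N.
Hypothesis a_le_k : forall i, i != ord_max -> (a i <= k)%N.
Implicit Types (d : nat -> C) (f : fps R n.+1) (al u v : mindex n.+1).

Definition gbound f := exists B K : R, [/\ 0 <= B, 1 <= K &
  forall al, nm (f al) <= B * K ^+ mdeg al * (al ord_max)`!%:R `^ (c%:R / k%:R - 1)].

Lemma gexp_ge0 : 0 <= c%:R / k%:R - 1 :> R.
Proof. by rewrite subr_ge0 ler_pdivlMr ?mul1r ?ltr0n // ler_nat. Qed.

Lemma fact_powR_ge1 m (x : R) : 0 <= x -> 1 <= m`!%:R `^ x.
Proof.
move=> x0; have f1 : 1 <= m`!%:R :> R by rewrite ler1n fact_gt0.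
by have := ler_powR f1 x0; rewrite powRr0.
Qed.

Lemma cbound_gbound f : cbound f -> gbound f.
Proof.
move=> [B [K [B0 K1 h]]]; exists B, K; split => // al.
apply: le_trans (h al) _; rewrite ler_peMr ?fact_powR_ge1 ?gexp_ge0 //.
by rewrite mulr_ge0 // exprn_ge0 // (le_trans ler01).
Qed.

Lemma gboundD f g : gbound f -> gbound g -> gbound (fun al => f al + g al).
Proof.
move=> [B [K [B0 K1 h]]] [B' [K' [B'0 K'1 h']]].
have K0 := le_trans ler01 K1; have K'0 := le_trans ler01 K'1.
exists (B + B'), (K * K'); split => [||al]; first exact: addr_ge0.
  by rewrite -[1]mulr1 ler_pM.
apply: le_trans (nmD _ _) _; rewrite mulrDl mulrDl exprMn.
apply: lerD; [apply: le_trans (h al) _ | apply: le_trans (h' al) _];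
  rewrite ler_wpM2r ?powR_ge0 // ler_wpM2l //.
  by rewrite ler_peMr ?exprn_ge0 ?exprn_ege1.
by rewrite ler_peMl ?exprn_ge0 ?exprn_ege1.
Qed.

Lemma gbound_gevrey f (s : \bar R) : ((c%:R / k%:R : R)%:E <= s)%E ->
  gbound f -> gevrey s f.
Proof.
move=> hs [B [K [B0 K1 h]]]; case: s hs => [r|_|] //=; last first.
  (* For s = +oo the power of x_n is fixed, and the factorial factor becomes a constant. *)
  exists (2 * K)^-1 => [|m]; first by rewrite invr_gt0 mulr_gt0 // (lt_le_trans ltr01).
  apply: (@esum_geom _ _ _ f (B * m`!%:R `^ (c%:R / k%:R - 1))) => // [|al alm].
    by rewrite mulr_ge0 // powR_ge0.
  by apply: le_trans (h al) _; rewrite alm mulrAC.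
rewrite lee_fin => hr; apply/convergentP; exists B, K; split=> // al.
have f1 : 1 <= (al ord_max)`!%:R :> R by rewrite ler1n fact_gt0.
have q0 : 0 < ((al ord_max)`!%:R : R) `^ (r - 1) by rewrite powR_gt0 // (lt_le_trans ltr01).
rewrite Normc.normcM Normc.normcV nm_real (ger0_norm (ltW q0)) ler_pdivrMr //.
apply: le_trans (h al) _; rewrite ler_wpM2l ?mulr_ge0 ?exprn_ge0 ?(le_trans ler01 K1) //.
by apply: ler_powR => //; rewrite lerD2r.
Qed.

(** With l the exponent of x_n and m the rest of the degree, the weight is at most k m + c l, so
    [mu k] is at most m! l!^(c/k) up to geometric factors. Dividing by al!, comparable to m! l!,
    leaves l!^(c/k - 1). *)
Lemma grow_gbound d : grow k d -> gbound (wseries a d).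
Proof.
move=> [B [K [B0 K1 h]]]; have K0 := le_trans ler01 K1.
have c1 : 1 <= c%:R :> R by rewrite ler1n.
exists B, (K ^+ c * 2 ^+ c * c%:R ^+ c * 2 ^+ n.+1); split => // [|al].
  by do 3?[rewrite -[leLHS]mulr1; apply: ler_pM => //]; rewrite ?exprn_ege1 ?ler1n // mulr_ge0 // exprn_ge0.
set l := al ord_max; pose m := (\sum_(i | i != ord_max) al i)%N.
have dE : mdeg al = (m + l)%N by rewrite /mdeg (bigD1 ord_max) //= addnC.
have f0 : 0 < (mfact al)%:R :> R by rewrite ltr0n mfact_gt0.
rewrite /wseries Normc.normcM Normc.normcV nm_nat ler_pdivrMr //.
have wl : (wgt a al <= k * m + c * l)%N.
  rewrite /wgt (bigD1 ord_max) //= addnC leq_add2r /m big_distrr /=.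
  by apply: leq_sum => i ni; rewrite leq_mul2r a_le_k ?orbT.
have wc : (k * m + c * l <= c * mdeg al)%N by rewrite dE mulnDr leq_add2r leq_mul2r k_le orbT.
have lE : (l`!%:R : R) * l`!%:R `^ (c%:R / k%:R - 1) = l`!%:R `^ (c%:R / k%:R).
  have l0 : 0 < l`!%:R :> R by rewrite ltr0n fact_gt0.
  rewrite -[X in X * _](powRr1 (ltW l0)) -powRD; last by apply/implyP => _; rewrite gt_eqF.
  by rewrite addrC subrK.
have ml : mu R k (c * l) <= c%:R ^+ (c * l) * l`!%:R `^ (c%:R / k%:R).
  apply: le_trans (root_le _ (y := c%:R ^+ (c * l) * l`!%:R ^+ c) _ _) _ => //.
    by rewrite -!natrX -natrM ler_nat fact_mul_le.
  rewrite rootM ?exprn_ge0 //; apply: ler_pM; rewrite ?root_ge0 //.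
    by apply: root_le_self; exact: exprn_ege1.
  by rewrite /root -powR_mulrn // -powRrM.
have mm : mu R k (k * m) <= c%:R ^+ (k * m) * m`!%:R.
  apply: le_trans (mu_le_fact _ k_gt0 (leqnn _)) _.
  rewrite ler_wpM2r // (@le_trans _ _ (c%:R ^+ m)) //.
    by rewrite lerXn2r ?nnegrE // ler_nat.
  by rewrite ler_weXn2l // leq_pmull.
have fd : m`!%:R * l`!%:R <= 2 ^+ (n.+1 * mdeg al) * (mfact al)%:R :> R.
  rewrite -natrX -!natrM ler_nat; apply: leq_trans (deg_fact_le al).
  rewrite dE -(bin_fact (leq_addr l m)) addKn leq_pmull // bin_gt0 leq_addr //.
apply: le_trans (h _) _.
apply: (@le_trans _ _ (B * (K ^+ (c * mdeg al) * (2 ^+ (c * mdeg al) *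
   (c%:R ^+ (c * mdeg al) * (2 ^+ (n.+1 * mdeg al) * (mfact al)%:R *
    l`!%:R `^ (c%:R / k%:R - 1))))))); last first.
  rewrite !exprMn -!exprM le_eqVlt; apply/orP; left; apply/eqP; ring.
rewrite -mulrA ler_wpM2l // ler_pM ?exprn_ge0 ?mu_ge0 //.
  by rewrite ler_weXn2l // (leq_trans wl wc).
apply: le_trans (mu_le R k wl) _; apply: le_trans (muD _ _ _ _) _.
apply: ler_pM; rewrite ?exprn_ge0 ?mulr_ge0 ?mu_ge0 //; first by rewrite ler_weXn2l ?ler1n.
apply: le_trans (ler_pM (mu_ge0 _ _ _) (mu_ge0 _ _ _) mm ml) _.
rewrite -lE mulrACA -exprD; apply: ler_pM; rewrite ?exprn_ge0 ?mulr_ge0 ?powR_ge0 //.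
  by rewrite ler_weXn2l.
by rewrite mulrA ler_wpM2r ?powR_ge0.
Qed.

End GevreyBound.

(** * The Gamma-series *)

Section BoxSums.
Variables (F : numFieldType) (n : nat) (a : 'I_n -> nat) (i0 : 'I_n).

(** A linear constraint on the box becomes the extraction of a coefficient from a product of
    one-variable polynomials. *)
Lemma box_sum_coef N J k (h : nat -> F) (t : 'I_n -> nat -> F) :
  \sum_(m : {ffun 'I_n -> 'I_N})
    (if (\sum_(i | i != i0) a i * m i == J + k * m i0)%N
     then h (m i0) * \prod_(i | i != i0) t i (m i) else 0) =
  \sum_(x < N) h x * (\prod_(i | i != i0) \sum_(r < N) t i r *: 'X^(a i * r))`_(J + k * x).
Proof.
rewrite (partition_big (fun m : {ffun 'I_n -> 'I_N} => m i0) predT) //=.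
apply: eq_bigr => x _.
(* Q pins the coordinate i0 to x and T gives it the factor 1, so that the product over all
   coordinates can be distributed. *)
pose Q (i : 'I_n) : pred 'I_N := fun j => (i == i0) ==> (j == x).
pose T (i : 'I_n) (j : 'I_N) : {poly F} := if i == i0 then 1 else t i j *: 'X^(a i * j).
have -> : \prod_(i | i != i0) \sum_(r < N) t i r *: 'X^(a i * r) =
    \prod_i \sum_(j | Q i j) T i j.
  rewrite [RHS](bigD1 i0) //= (eq_bigl (pred1 x)) => [|j]; last by rewrite /Q eqxx.
  rewrite big_pred1_eq /T eqxx mul1r; apply: eq_bigr => i /negbTE ni.
  by apply: eq_big => [j|j _]; rewrite /Q ni.
rewrite bigA_distr_big_dep /= coef_sum mulr_sumr.
apply: eq_big => [m|m /eqP mx].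
  apply/eqP/familyP => [mx i|/(_ i0)]; rewrite unfold_in /Q.
    by apply/implyP => /eqP ->; rewrite mx.
  by rewrite eqxx => /eqP.
have -> : \prod_i T i (m i) =
    (\prod_(i | i != i0) t i (m i)) *: 'X^(\sum_(i | i != i0) a i * m i).
  rewrite (bigD1 i0) //= {1}/T eqxx mul1r.
  transitivity (\prod_(i | i != i0) (t i (m i) *: 'X^(a i * m i))).
    by apply: eq_bigr => i /negbTE ni; rewrite /T ni.
  by rewrite scaler_prod prodrXr.
rewrite coefZ coefXn mx eq_sym; case: eqP => _; by rewrite ?mulr1 ?mulr0.
Qed.
End BoxSums.

Section ComplexPowers.
Variable R : realType.
Notation C := R[i].
Implicit Types x y z l g : C.

Lemma cexpD x y : cexp (x + y) = cexp x * cexp y.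
Proof.
case: x y => [a b] [c d]; rewrite /cexp /= expRD sinD cosD.
by apply/eqP; rewrite eq_complex /=; apply/andP; split; apply/eqP; ring.
Qed.

Lemma cexp0 : cexp (0 : C) = 1.
Proof. by rewrite /cexp /= expR0 cos0 sin0 mulr0 mulr1. Qed.

Lemma cexp_neq0 x : cexp x != 0.
Proof.
apply/eqP => h; have := cexpD x (- x); rewrite subrr cexp0 h mul0r => /eqP.
by rewrite oner_eq0.
Qed.

Lemma cexpMn l m : cexp (m%:R * l) = cexp l ^+ m.
Proof.
elim: m => [|m IH]; first by rewrite mul0r cexp0.
by rewrite -natr1 mulrDl mul1r cexpD IH exprSr.
Qed.

Lemma cexp_subn g l m : cexp ((g - m%:R) * l) = cexp (g * l) / cexp l ^+ m.
Proof.
rewrite -cexpMn; apply: (mulIf (cexp_neq0 (m%:R * l))).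
by rewrite divfK ?cexp_neq0 // -cexpD -mulrDl subrK.
Qed.

Lemma cffactS g m : cffact g m.+1 = cffact g m * (g - m%:R).
Proof. by rewrite /cffact big_ord_recr. Qed.

Lemma cffactD g m d : cffact g (m + d) = cffact g m * cffact (g - m%:R) d.
Proof.
elim: d => [|d IH]; first by rewrite addn0 /cffact [X in _ = _ * X]big_ord0 mulr1.
by rewrite addnS !cffactS IH -mulrA natrD opprD addrA.
Qed.

Lemma nm_cffact g m : nm (cffact g m) <= (nm g + 1) ^+ m * m`!%:R.
Proof.
have g0 := nm_ge0 g.
elim: m => [|m IH]; first by rewrite /cffact big_ord0 Normc.normc1 mulr1.
rewrite cffactS Normc.normcM exprSr factS mulnC natrM mulrACA.
apply: ler_pM; rewrite ?nm_ge0 //; apply: le_trans (nmB _ _) _.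
have m0 : 0 <= m%:R :> R by [].
by rewrite nm_nat -natr1; nra.
Qed.

Lemma cffact_neq0 g m : (forall j : nat, g != j%:R) -> cffact g m != 0.
Proof. by move=> h; rewrite /cffact; apply/prodf_neq0 => i _; rewrite subr_eq0. Qed.

Lemma cffact_opp1 m : cffact (-1 : C) m = (-1) ^+ m * m`!%:R.
Proof.
elim: m => [|m IH]; first by rewrite /cffact big_ord0 mulr1.
by rewrite cffactS IH factS exprS natrM -natr1; ring.
Qed.

(** Dominated convergence for sums whose terms and length both depend on N: beyond N - A the terms
    add up to at most 2 B 2^-(N-A). *)
Lemma clim_dominated (B : R) (v : nat -> C) (q : nat -> nat -> C) (V : nat -> nat) A L :
  (forall N s, (s < N - A)%N -> q N s = v s) ->
  (forall N s, nm (q N s) <= B * 2^-1 ^+ s) ->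
  (forall N, (N - A <= V N)%N) ->
  clim (fun N => \sum_(s < N) v s) L -> clim (fun N => \sum_(s < V N) q N s) L.
Proof.
move=> qv qB hV hL; rewrite -[L]addr0.
apply: (clim_ext (u := fun N => \sum_(s < N - A) v s +
   (\sum_(s < V N) q N s - \sum_(s < N - A) v s))); first by move=> N; rewrite addrC subrK.
apply: climD (clim_subn A hL) _.
apply: (@clim_geom _ A (B * 2)) => N _; rewrite subr0.
have [m mE] : exists m, V N = (N - A + m)%N by exists (V N - (N - A))%N; rewrite subnKC.
rewrite mE big_split_ord /= -[X in nm X](_ : \sum_(s < m) q N (N - A + s)%N = _); last first.
  by rewrite addrAC -sumrB [X in _ = X + _]big1 ?add0r // => s _; rewrite qv ?subrr.
apply: le_trans (nm_sum _ _ _) _.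
apply: (@le_trans _ _ (\sum_(s < m) B * 2^-1 ^+ (N - A) * 2^-1 ^+ s)).
  by apply: ler_sum => s _; apply: le_trans (qB _ _) _; rewrite exprD mulrA.
have B0 : 0 <= B by have := le_trans (nm_ge0 _) (qB 0%N 0%N); rewrite expr0 mulr1.
rewrite -mulr_sumr -[leRHS]mulrA [2 * _]mulrC mulrA; apply: ler_wpM2l (geom_half_sum _ _).
by rewrite mulr_ge0 // exprn_ge0 // invr_ge0.
Qed.

End ComplexPowers.

(** * Solutions of the two-term recurrence *)

Section PhiSequence.
Variables (R : realType) (k : nat).
Notation C := R[i].
Hypothesis k_gt0 : (0 < k)%N.
Variables (beta l : C) (J : nat).

Let g : C := (beta - J%:R) / k%:R.

(** J! times the x-th derivative of z^g at z = exp l, for the branch fixed by l. *)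
Definition phi_coef (x : nat) : C := J`!%:R * cffact g x * cexp ((g - x%:R) * l).

Definition phi_seq (v : nat) : C :=
  \sum_(x < v.+1) (if v == (J + k * x)%N then phi_coef x else 0).

Lemma phi_seq_at x : phi_seq (J + k * x) = phi_coef x.
Proof.
have xv : (x < (J + k * x).+1)%N by nia.
rewrite /phi_seq (bigD1 (Ordinal xv)) //= eqxx big1 ?addr0 // => y yx.
rewrite ifF //; apply/negP => /eqP e; case/eqP: yx; apply: val_inj => /=; nia.
Qed.

Lemma phi_seq_off v : (forall x, v <> J + k * x)%N -> phi_seq v = 0.
Proof. by move=> h; rewrite /phi_seq big1 // => x _; case: eqP => // /h. Qed.

Lemma phi_seq_cut N v : (v < J + k * N)%N ->
  phi_seq v = \sum_(x < N) (if v == (J + k * x)%N then phi_coef x else 0).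
Proof.
move=> vN; case: (pselect (exists x, v = J + k * x)%N) => [[x vx]|nx]; last first.
  rewrite phi_seq_off => [|x vx]; last by apply: nx; exists x.
  by rewrite big1 // => x _; case: eqP => // vx; case: nx; exists x.
have xN : (x < N)%N by nia.
rewrite [in LHS]vx phi_seq_at (bigD1 (Ordinal xN)) //= {1}vx eqxx big1 ?addr0 // => y yx.
rewrite ifF //; apply/negP => /eqP e; case/eqP: yx; apply: val_inj => /=; nia.
Qed.

(** (g)_(x+1) = (g)_x (g - x) and k (g - x) = beta - (J + k x). The bound on v matters: v = J - k
    would see only the first entry of the sequence. *)
Lemma phi_seq_rec v : (J <= v)%N ->
  k%:R * cexp l * phi_seq (v + k) - (beta - v%:R) * phi_seq v = 0.
Proof.
move=> Jv; have k0 : k%:R != 0 :> C by rewrite pnatr_eq0 -lt0n.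
case: (pselect (exists x, v = J + k * x)%N) => [[x vx]|nx]; last first.
  rewrite (@phi_seq_off v) => [|x vx]; last by apply: nx; exists x.
  rewrite phi_seq_off ?mulr0 ?subr0 // => -[|x] vx; first by move: vx; lia.
  by apply: nx; exists x; lia.
have -> : (v + k = J + k * x.+1)%N by lia.
rewrite vx !phi_seq_at /phi_coef !cexp_subn cffactS exprS natrD natrM /g.
by field; rewrite k0 expf_neq0 ?cexp_neq0.
Qed.

Lemma grow_phi_seq : grow k phi_seq.
Proof.
pose q := (nm (cexp l))^-1; have q0 : 0 <= q by rewrite invr_ge0 nm_ge0.
pose K := (nm g + 1) * Num.max 1 q.
have g1 : 1 <= nm g + 1 by rewrite lerDr nm_ge0.
have m1 : 1 <= Num.max 1 q by rewrite le_max lexx.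
have K1 : 1 <= K by rewrite /K -[leLHS]mulr1 ler_pM.
pose B := J`!%:R * nm (cexp (g * l)).
have B0 : 0 <= B by rewrite mulr_ge0 ?nm_ge0.
exists B, K; split=> // v.
have K0 m : 0 <= K ^+ m by rewrite exprn_ge0 // (le_trans ler01).
case: (pselect (exists x, v = J + k * x)%N) => [[x vx]|nx]; last first.
  rewrite phi_seq_off => [|x vx]; last by apply: nx; exists x.
  by rewrite Normc.normc0; exact: mulr_ge0 (mulr_ge0 B0 (K0 _)) (mu_ge0 _ _ _).
rewrite {1}vx phi_seq_at /phi_coef cexp_subn !Normc.normcM Normc.normcV nmX nm_nat.
have -> : J`!%:R * nm (cffact g x) * (nm (cexp (g * l)) / nm (cexp l) ^+ x) =
  B * (nm (cffact g x) * q ^+ x) by rewrite /B exprVn; ring.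
rewrite -mulrA ler_wpM2l //.
apply: (@le_trans _ _ (K ^+ x * x`!%:R)).
  rewrite /K exprMn mulrAC; apply: ler_pM; rewrite ?nm_ge0 ?exprn_ge0 //.
    exact: nm_cffact.
  by rewrite lerXn2r ?nnegrE ?le_max ?ler01 ?q0 ?lexx ?orbT.
apply: ler_pM => //; first by rewrite ler_weXn2l // vx; nia.
by apply: le_trans (mu_ge_fact R x k_gt0) _; apply: mu_le; rewrite vx leq_addl.
Qed.

End PhiSequence.

(** The e-th divided derivative in x of the truncated exponential: it brings down T^(m e) / e! and
    shortens the truncation by e. *)
Lemma texp_taylor (F : numFieldType) (m e N : nat) (x : F) :
  \sum_(r < N) ('C(r, e)%:R * x ^+ (r - e) / r`!%:R) *: 'X^(m * r) =
  (e`!%:R)^-1 *: ('X^(m * e) * texp m x (N - e)).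
Proof.
have f0 j : j`!%:R != 0 :> F by rewrite pnatr_eq0 -lt0n fact_gt0.
have [Ne|eN] := leqP N e.
  rewrite (eqP Ne) /texp [in RHS]big_ord0 mulr0 scaler0 big1 // => r _.
  by rewrite bin_small ?mul0r ?scale0r //; apply: leq_trans (ltn_ord r) _.
have [j ->] : exists j, N = (e + j)%N by exists (N - e)%N; rewrite subnKC // ltnW.
rewrite addKn big_split_ord /= [X in X + _]big1 ?add0r => [|r _]; last first.
  by rewrite bin_small ?mul0r ?scale0r.
rewrite /texp mulr_sumr scaler_sumr; apply: eq_bigr => r _.
rewrite addKn -scalerAr scalerA -exprD mulnDr; congr (_ *: _).
rewrite -(bin_fact (leq_addr r e)) addKn !natrM.
have b0 : 'C(e + r, e)%:R != 0 :> F by rewrite pnatr_eq0 -lt0n bin_gt0 leq_addr.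
by field; rewrite b0 !f0.
Qed.

(** * The Gamma-series as transforms of these sequences *)

Section PhiSeries.
Variables (R : realType) (n : nat) (a : 'I_n.+2 -> nat).
Notation C := R[i].
Notation pen := (penult n).
Notation k := (a pen).
Hypothesis a_gt0 : forall i, (0 < a i)%N.
Variables (p : 'rV[C]_n.+2) (beta l : C) (J : nat).
Hypothesis a_lt_k : forall i, i != pen -> p 0 i != 0 -> (a i < k)%N.

Let P : pred 'I_n.+2 := fun i => i != pen.
Let k_gt0 : (0 < k)%N. Proof. exact: a_gt0. Qed.
Let g : C := (beta - J%:R) / k%:R.
Notation D0 := (phi_seq k beta l J).

Definition phi_term (al m : mindex n.+2) : C :=
  if weight_but a m == (J + k * m pen)%N then
    cffact g (m pen) * J`!%:R / (fact_but m)%:R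
    * cpow_taylor l (g - (m pen)%:R) (al pen) * mon_taylor p m al
  else 0.

(* The part of the sequence that the coefficient of index al can see: the
   exponent of x_{n-1} was differentiated (al pen) times. *)
Definition cut_seq (al : mindex n.+2) (v : nat) : C :=
  if (J + k * al pen <= v)%N then D0 v else 0.

(** A box partial sum is a partial sum of the transform, with distorted truncations: taking the
    Taylor coefficient al shortens the i-th exponential to N - al i terms and shifts the index of
    [phi_coef] by al pen. *)
Lemma phi_boxE (al : mindex n.+2) N :
  (mfact al)%:R * (\sum_(m : {ffun 'I_n.+2 -> 'I_N}) phi_term al [ffun i => nat_of_ord (m i)]) =
  \sum_(s < J + k * (N + al pen) - wgt a al)
    (pexp P a (p 0) (fun i => N - al i)%N)`_s * cut_seq al (wgt a al + s).
Proof.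
set d := al pen; set w := wgt a al.
pose w' := (\sum_(i | i != pen) a i * al i)%N.
have wE : w = (w' + k * d)%N by rewrite /w /wgt (bigD1 pen) //= addnC.
pose h (x : nat) := cffact g x * J`!%:R * cpow_taylor l (g - x%:R) d.
pose t i (x : nat) := 'C(x, al i)%:R * p 0 i ^+ (x - al i) / x`!%:R.
pose fo : C := (\prod_(i | i != pen) (al i)`!)%N%:R.
have fact0 x : x`!%:R != 0 :> C by rewrite pnatr_eq0 -lt0n fact_gt0.
have -> : \sum_(m : {ffun 'I_n.+2 -> 'I_N}) phi_term al [ffun i => nat_of_ord (m i)] =
  \sum_(m : {ffun 'I_n.+2 -> 'I_N})
    (if (\sum_(i | i != pen) a i * m i == J + k * m pen)%N
     then h (m pen) * \prod_(i | i != pen) t i (m i) else 0).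
  apply: eq_bigr => m _; rewrite /phi_term /weight_but ffunE.
  under eq_bigr do rewrite ffunE.
  case: eqP => // _; rewrite /h -/d.
  have -> : \prod_(i | i != pen) t i (m i) =
      mon_taylor p [ffun i => nat_of_ord (m i)] al / (fact_but [ffun i => nat_of_ord (m i)])%:R.
    rewrite /mon_taylor /fact_but natr_prod -prodfV -big_split /=.
    by apply: eq_bigr => i _; rewrite ffunE.
  ring.
rewrite box_sum_coef.
have -> : \prod_(i | i != pen) \sum_(r < N) t i r *: 'X^(a i * r) =
    fo^-1 *: ('X^w' * pexp P a (p 0) (fun i => N - al i)%N).
  rewrite /t; under eq_bigr do rewrite texp_taylor.
  rewrite scaler_prod big_split /= prodrXr; congr (_ *: _).
  by rewrite /fo natr_prod prodfV.
have hE x : (mfact al)%:R * (h x * fo^-1) = phi_coef k beta l J (x + d).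
  have -> : (mfact al)%:R = d`!%:R * fo by rewrite /mfact (bigD1 pen) //= natrM.
  have fo0 : fo != 0 by rewrite pnatr_eq0 -lt0n prodn_gt0 // => i; exact: fact_gt0.
  rewrite /h /cpow_taylor /phi_coef cffactD natrD opprD addrA -/g.
  by field; rewrite fact0 fo0.
transitivity (\sum_(x < N) phi_coef k beta l J (x + d) *
    (if (J + k * (x + d) < w)%N then 0
     else (pexp P a (p 0) (fun i => N - al i)%N)`_(J + k * (x + d) - w))).
  rewrite mulr_sumr; apply: eq_bigr => x _.
  rewrite coefZ -hE !mulrA; congr (_ * _).
  rewrite coefXnM wE mulnDr addnA ltn_add2r; case: ltnP => // _.
  by rewrite subnDr.
have cutE s : (s < J + k * (N + d) - w)%N -> cut_seq al (w + s) =
    \sum_(x < N) (if (w + s == J + k * (x + d))%N then phi_coef k beta l J (x + d) else 0).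
  move=> sN; have wsN : (w + s < J + k * d + k * N)%N by rewrite mulnDr in sN; lia.
  rewrite /cut_seq -/d; case: leqP => h0.
    rewrite (@phi_seq_cut _ _ k_gt0 _ _ _ (d + N)); last by rewrite mulnDr; lia.
    rewrite big_split_ord /= big1 ?add0r => [|x _].
      by apply: eq_bigr => x _; rewrite [(d + _)%N]addnC.
    rewrite ifF //; apply/negP => /eqP /= e.
    by have : (k * x < k * d)%N; [rewrite ltn_pmul2l | lia].
  rewrite big1 // => x _; rewrite ifF //; apply/negP => /eqP e; move: h0; rewrite e mulnDr; lia.
transitivity (\sum_(s < J + k * (N + d) - w) \sum_(x < N)
   (pexp P a (p 0) (fun i => N - al i)%N)`_s *
   (if (w + s == J + k * (x + d))%N then phi_coef k beta l J (x + d) else 0)); last first.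
  by apply: eq_bigr => s _; rewrite cutE // mulr_sumr.
rewrite exchange_big /=; apply: eq_bigr => x _.
case: ltnP => hx.
  rewrite mulr0 big1 // => s _; rewrite ifF ?mulr0 //; apply/negP => /eqP e; lia.
have xd : (J + k * (x + d) - w < J + k * (N + d) - w)%N.
  by have : (k * (x + d) < k * (N + d))%N; [rewrite ltn_pmul2l // ltn_add2r | lia].
rewrite (bigD1 (Ordinal xd)) //= subnKC // eqxx mulrC big1 ?addr0 // => s sx.
rewrite ifF ?mulr0 //; apply/negP => /eqP e; case/eqP: sx; apply: val_inj => /=; lia.
Qed.

Lemma grow_cut_seq al : grow k (cut_seq al).
Proof.
have [B [K [B0 K1 h]]] := grow_phi_seq k_gt0 beta l J.
exists B, K; split=> // v; rewrite /cut_seq; case: ifP => _; first exact: h.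
by rewrite Normc.normc0 (le_trans (nm_ge0 _) (h v)).
Qed.

Lemma phi_etrans al : (mfact al)%:R * phi a p beta l J al =
  etrans P a (p 0) (cut_seq al) (wgt a al).
Proof.
pose S N := \sum_(m : {ffun 'I_n.+2 -> 'I_N}) phi_term al [ffun i => nat_of_ord (m i)].
set L := etrans _ _ _ _ _.
have gc := grow_cut_seq al.
have hL : clim (fun N => (mfact al)%:R * S N) L.
  apply: (clim_ext (u := fun N => \sum_(s < J + k * (N + al pen) - wgt a al)
    (pexp P a (p 0) (fun i => N - al i)%N)`_s * cut_seq al (wgt a al + s))).
    by move=> N; rewrite phi_boxE.
  have [B [K [B0 K1 hb]]] := etrans_bound a_gt0 k_gt0 a_lt_k gc.
  (* The summand |al| covers the shortened truncations, and wgt al the weight subtracted from the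
     length of the sum. *)
  apply: (@clim_dominated _ (B * K ^+ wgt a al * mu R k (wgt a al))
    (fun s => ecoef P a (p 0) s * cut_seq al (wgt a al + s)%N)
    (fun N s => (pexp P a (p 0) (fun i => N - al i)%N)`_s * cut_seq al (wgt a al + s)%N)
    _ (mdeg al + wgt a al)) => [N s sN|N s|N|].
  - rewrite pexp_coef // => i; have := leq_mdeg al i; lia.
  - rewrite Normc.normcM; apply: le_trans (_ : ecoef P a (fun i => nm (p 0 i)) s *
        nm (cut_seq al (wgt a al + s)) <= _).
      by rewrite ler_wpM2r ?nm_ge0 // nm_pexp_coef.
    apply: le_trans (hb _ _) _; rewrite ler_wpM2l ?exprV4_le //.
    by rewrite !mulr_ge0 ?exprn_ge0 ?mu_ge0 // (le_trans ler01).
  - have : (N <= k * (N + al pen))%N by apply: leq_trans (leq_pmull _ k_gt0); rewrite leq_addr.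
    lia.
  - exact: (etrans_lim a_gt0 k_gt0 a_lt_k (wgt a al) gc).
have m0 : (mfact al)%:R != 0 :> C := mfact_neq0 R al.
have hS : clim S ((mfact al)%:R^-1 * L).
  by apply: clim_ext (climZ (mfact al)%:R^-1 hL) => N; rewrite mulKf.
by rewrite /phi /csum (clim_lim hS) mulVKf.
Qed.

(** [cut_seq] and [phi_seq] differ only below J + k al_pen, and wgt al >= k al_pen, so at most J
    terms of the transform change. They sit at weights below J + k |al|, where [mu k] is about
    |al|!: a convergent error. *)
Lemma phi_approx : cbound (fun al => phi a p beta l J al - wseries a (etrans P a (p 0) D0) al).
Proof.
have gD := grow_phi_seq k_gt0 beta l J.
have [B [K [B0 K1 h]]] := gD; have K0 := le_trans ler01 K1.
pose E : R := \sum_(s < J) nm (ecoef P a (p 0) s).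
have E0 : 0 <= E by apply: sumr_ge0 => s _; exact: nm_ge0.
pose B' := E * (B * K ^+ J * 2 ^+ J * mu R k J).
have B'0 : 0 <= B' by rewrite !mulr_ge0 ?exprn_ge0 ?mu_ge0.
have k1 : 1 <= k%:R :> R by rewrite ler1n.
apply: (@mfact_cbound _ _ _ B' (K ^+ k * 2 ^+ k * k%:R)) => // [|al].
  by rewrite -[leLHS]mulr1 ler_pM // -[leLHS]mulr1 ler_pM ?exprn_ege1 ?ler1n.
rewrite mulrBr phi_etrans /wseries [_ * (_ / _)]mulrC divfK ?mfact_neq0 //.
set d := al pen; have dal : (d <= mdeg al)%N := leq_mdeg al pen.
have wd : (k * d <= wgt a al)%N by rewrite /wgt (bigD1 pen) //= leq_addr.
have -> : etrans P a (p 0) (cut_seq al) (wgt a al) - etrans P a (p 0) D0 (wgt a al) =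
    \sum_(s < J) ecoef P a (p 0) s * (cut_seq al (wgt a al + s) - D0 (wgt a al + s)).
  apply: (clim_unique (u := fun N => etrans_part P a (p 0) (cut_seq al) (wgt a al) N -
      etrans_part P a (p 0) D0 (wgt a al) N)).
    apply: climD; first exact: (etrans_lim a_gt0 k_gt0 a_lt_k (wgt a al) (grow_cut_seq al)).
    by apply: climN; exact: (etrans_lim a_gt0 k_gt0 a_lt_k (wgt a al) gD).
  apply: (@clim_near _ J (fun=> \sum_(s < J) ecoef P a (p 0) s *
    (cut_seq al (wgt a al + s) - D0 (wgt a al + s)))); last exact: clim_cst.
  move=> N JN; rewrite /etrans_part -sumrB.
  have [j ->] : exists j, N = (J + j)%N by exists (N - J)%N; rewrite subnKC.
  rewrite [RHS]big_split_ord /= [X in _ = _ + X]big1 ?addr0.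
    by apply: eq_bigr => s _; rewrite mulrBr.
  move=> s _; rewrite /cut_seq ifT ?subrr //; move: wd; rewrite -/d; lia.
apply: le_trans (nm_sum _ _ _) _.
have kd : (k * d <= k * mdeg al)%N by rewrite leq_mul2l dal orbT.
apply: (@le_trans _ _ (\sum_(s < J) nm (ecoef P a (p 0) s) *
   (B * K ^+ (J + k * mdeg al) * mu R k (J + k * mdeg al)))).
  apply: ler_sum => s _; rewrite Normc.normcM ler_wpM2l ?nm_ge0 //.
  rewrite /cut_seq -/d; case: leqP => hs.
    by rewrite subrr Normc.normc0 !mulr_ge0 ?exprn_ge0 ?mu_ge0.
  rewrite sub0r normcN; apply: le_trans (h _) _.
  rewrite -!mulrA ler_wpM2l // ler_pM ?exprn_ge0 ?mu_ge0 //.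
    by rewrite ler_weXn2l //; lia.
  by apply: mu_le; lia.
rewrite -mulr_suml -/E /B' -!mulrA ler_wpM2l // ler_wpM2l //.
rewrite exprD -mulrA ler_wpM2l ?exprn_ge0 // !exprMn -!exprM.
apply: (@le_trans _ _ (K ^+ (k * mdeg al) * (2 ^+ (J + k * mdeg al) *
   (mu R k J * (k%:R ^+ mdeg al * (mdeg al)`!%:R))))).
  rewrite ler_wpM2l ?exprn_ge0 //; apply: le_trans (muD _ _ _ _) _.
  rewrite ler_wpM2l ?exprn_ge0 // ler_wpM2l ?mu_ge0 //.
  exact: mu_le_fact.
by rewrite exprD le_eqVlt; apply/orP; left; apply/eqP; ring.
Qed.

End PhiSeries.

(** J = b + k makes the exponent -1, and (-1)_m = (-1)^m m!; integral exponents make the powers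
    independent of the logarithm l. *)
Lemma phi_tildeE (R : realType) (n : nat) (a : 'I_n.+2 -> nat)
    (p : 'rV[R[i]]_n.+2) (b : nat) (l : R[i]) : (0 < a (penult n))%N ->
  cexp l = p 0 (penult n) ->
  phi_tilde a p b = phi a p b%:R l (b + a (penult n)).
Proof.
move=> k0 hl; apply/funext => al; rewrite /phi_tilde /phi; congr csum; apply/funext => m /=.
have kn0 : (a (penult n))%:R != 0 :> R[i] by rewrite pnatr_eq0 -lt0n.
have -> : (b%:R - (b + a (penult n))%:R) / (a (penult n))%:R = -1 :> R[i].
  by rewrite natrD opprD addrA subrr sub0r mulNr divff.
rewrite -addnA; case: ifP => // _; congr (_ * _).
rewrite cffact_opp1 /cpow_taylor.
have -> : -1 - (m (penult n))%:R = - (m (penult n)).+1%:R :> R[i] by rewrite -natr1 opprD addrC.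
congr (_ * (_ * _)).
by rewrite -opprD -natrD -[- _]sub0r cexp_subn mul0r cexp0 hl mul1r.
Qed.

(** * The basis *)

Section Assembly.
Variables (R : realType) (n : nat) (a : 'I_n.+2 -> nat).
Notation C := R[i].
Notation pen := (penult n).
Notation k := (a pen).
Notation c := (a ord_max).
Hypothesis a_gt0 : (0 < a ord0)%N.
Hypothesis a_incr : forall i j : 'I_n.+2, (i < j)%N -> (a i < a j)%N.
Hypothesis a_gcd : \big[gcdn/0%N]_(i < n.+2) a i = 1%N.
Variables (p : 'rV[C]_n.+2) (beta : C).
Hypothesis pY : p 0 ord_max = 0.
Hypothesis pZ : p 0 pen != 0.

Let a_pos i : (0 < a i)%N.
Proof.
have [->|i0] := eqVneq i ord0; first exact: a_gt0.
by apply: leq_ltn_trans (a_incr (i := ord0) _); rewrite // lt0n.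
Qed.

Let pen_val : val pen = n. Proof. by rewrite /penult /= inordK. Qed.

Let a_le_pen i : i != ord_max -> (a i <= k)%N.
Proof.
move=> i0; have [->//|ip] := eqVneq i pen; apply/ltnW/a_incr.
rewrite -[nat_of_ord pen]/(val pen) pen_val.
have := ltn_ord i; move: i0 ip; rewrite -!val_eqE /= -[nat_of_ord pen]/(val pen) pen_val; lia.
Qed.

Let a_lt_pen i : i != pen -> p 0 i != 0 -> (a i < k)%N.
Proof.
move=> ip pi; have im : i != ord_max by apply: contraNneq pi => ->; rewrite pY.
apply: a_incr; rewrite -[nat_of_ord pen]/(val pen) pen_val.
have := ltn_ord i; move: im ip; rewrite -!val_eqE /= -[nat_of_ord pen]/(val pen) pen_val; lia.
Qed.

Let pen_lt_last : (k < c)%N.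
Proof. by apply: a_incr; rewrite -[nat_of_ord pen]/(val pen) pen_val /=. Qed.

Let a_le_last i : (a i <= c)%N.
Proof.
by have [->//|/a_le_pen h] := eqVneq i ord_max; apply: leq_trans h (ltnW _).
Qed.

Let a_lt_last i : p 0 i != 0 -> (a i < c)%N.
Proof.
move=> pi; have [->//|ip] := eqVneq i pen.
exact: ltn_trans (a_lt_pen ip pi) pen_lt_last.
Qed.

Let P : pred 'I_n.+2 := fun i => i != pen.
Notation rho' := (rho a (p 0) beta).

Lemma rho_lin (d d' : nat -> C) (x : C) w :
  rho' (fun v => d v + x * d' v) w = rho' d w + x * rho' d' w.
Proof.
rewrite /rho (_ : \sum_i _ = \sum_i (a i)%:R * p 0 i * d (w + a i)%N +
  x * (\sum_i (a i)%:R * p 0 i * d' (w + a i)%N)); first by ring.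
by rewrite mulr_sumr -big_split /=; apply: eq_bigr => i _; ring.
Qed.

Lemma rho_sum (m : nat) (x : 'I_m -> C) (d : 'I_m -> nat -> C) w :
  rho' (fun v => \sum_j x j * d j v) w = \sum_j x j * rho' (d j) w.
Proof.
rewrite /rho; under eq_bigr do rewrite mulr_sumr.
rewrite exchange_big /= mulr_sumr -sumrB; apply: eq_bigr => j _.
rewrite mulrBr mulr_sumr; congr (_ - _); last by ring.
by apply: eq_bigr => i _; ring.
Qed.

(* The recurrence determines x (w + k) from the earlier values, because
   p_n = 0 removes the only index beyond a_{n-1}. *)
Lemma rho_determined M (x : nat -> C) : (forall w, (M <= w)%N -> rho' x w = 0) ->
  (forall i, (i < k)%N -> x (M + i)%N = 0) -> forall w, (M <= w)%N -> x w = 0.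
Proof.
move=> rx x0; elim/ltn_ind => w IH Mw.
have [wk|kw] := ltnP w (M + k); first by rewrite -(subnKC Mw) x0 // ltn_subLR.
have k0 := a_pos pen.
have [u wE] : exists u, w = (u + k)%N by exists (w - k)%N; rewrite subnK //; lia.
have Mu : (M <= u)%N by lia.
have := rx u Mu; rewrite /rho (bigD1 pen) //= -wE big1 => [|i ip].
  rewrite addr0 (IH u) ?mulr0 ?subr0 //; last by lia.
  move/eqP; rewrite !mulf_eq0 pnatr_eq0 (negbTE pZ) orbF => /orP[/eqP h|/eqP//].
  by move: k0; rewrite h.
have [->|pi] := eqVneq (p 0 i) 0; first by rewrite mulr0 mul0r.
have aik := a_lt_pen ip pi.
by rewrite (IH (u + a i)%N) ?mulr0 //; lia.
Qed.

(* J is the identity in case (i); in case (ii) J q = beta + k, which turns phi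
   into phi_tilde. *)
Section Basis.
Variables (J : 'I_k -> nat) (l : 'I_k -> C).
Hypothesis hl : forall j, cexp (l j) = p 0 pen.
Hypothesis J_mod : forall j : 'I_k, J j = j %[mod k].
Hypothesis J_exp : forall (j : 'I_k) (m : nat), (beta - (J j)%:R) / k%:R != m%:R.

Let S j := phi_seq k beta (l j) (J j).
Let D j := etrans P a (p 0) (S j).
Let Jmax := (\sum_j J j)%N.

Let grow_S j : grow k (S j). Proof. exact: grow_phi_seq. Qed.

Let J_le j : (J j <= Jmax)%N. Proof. by rewrite /Jmax (bigD1 j) //= leq_addr. Qed.

(** With the term i = pen set apart, [etrans_rho] reduces the claim to [phi_seq_rec], valid from J j
    on; the transform only looks at larger weights. *)
Lemma rho_etrans_phi j w : (Jmax <= w)%N -> rho' (D j) w = 0.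
Proof.
move=> Jw; rewrite /rho (bigD1 pen) //= [X in X - _]addrC.
rewrite (etrans_rho a_pos (a_pos pen) a_lt_pen) //.
apply: (@etrans_finsupp _ _ _ _ _ (J j)); last exact: leq_trans (J_le j) Jw.
by move=> v Jv; rewrite -(hl j) (phi_seq_rec (a_pos pen) beta (l j) Jv).
Qed.

(** Injectivity of the transform brings the relation back to the S j. These live on distinct residue
    classes modulo k, and their entries are nonzero because the exponent is not a natural number. *)
Lemma etrans_phi_free M (x : 'I_k -> C) :
  (forall w, (M <= w)%N -> \sum_j x j * D j w = 0) -> forall j, x j = 0.
Proof.
move=> h j.
have hS v : (M <= v)%N -> \sum_j x j * S j v = 0.
  have gS : grow k (fun v => \sum_j x j * S j v).
    by apply: grow_sum => j'; apply: growZ.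
  apply: (etrans_inj a_pos (a_pos pen) a_lt_pen gS) => w Mw.
  by rewrite (etrans_sum a_pos (a_pos pen) a_lt_pen) // h.
have k0 := a_pos pen.
have Mv : (M <= J j + k * M)%N by nia.
have := hS _ Mv; rewrite (bigD1 j) //= big1 => [|j' jj].
  rewrite addr0 /S phi_seq_at // => /eqP; rewrite mulf_eq0 => /orP[/eqP//|].
  rewrite /phi_coef !mulf_eq0 (negbTE (cexp_neq0 _)) orbF pnatr_eq0 (gtn_eqF (fact_gt0 _)) /=.
  by rewrite (negbTE (cffact_neq0 _ _)).
rewrite /S phi_seq_off ?mulr0 // => y e; case/eqP: jj; apply: val_inj => /=.
have := congr1 (modn^~ k) e; rewrite ![(k * _)%N]mulnC ![(_ + _ * k)%N]addnC !modnMDl !J_mod.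
by rewrite !modn_small.
Qed.

(** The Casorati matrix of the D j at M, ..., M + k - 1 is invertible: a null vector would give a
    combination with k consecutive zeros, hence zero from M on. Matching the first k values of x
    then matches all later ones. *)
Lemma etrans_phi_span M (x : nat -> C) : (Jmax <= M)%N ->
  (forall w, (M <= w)%N -> rho' x w = 0) ->
  exists y : 'I_k -> C, forall w, (M <= w)%N -> x w = \sum_j y j * D j w.
Proof.
move=> JM rx; pose A : 'M[C]_k := \matrix_(j, i) D j (M + i)%N.
have rD w : (M <= w)%N -> forall y : 'I_k -> C, rho' (fun v => \sum_j y j * D j v) w = 0.
  move=> Mw y; rewrite rho_sum big1 // => j _.
  by rewrite rho_etrans_phi ?mulr0 //; exact: leq_trans Mw.
have A_unit : A \in unitmx.
  rewrite unitmxE unitfE; apply/det0P => -[v v0 vA]; case/eqP: v0.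
  apply/rowP => j; rewrite mxE.
  apply: (@etrans_phi_free M (fun j => v 0 j)) => w Mw.
  apply: (@rho_determined M (fun w => \sum_j v 0 j * D j w)) => // [u Mu|i ik]; first exact: rD.
  have := congr1 (fun B : 'rV_k => B 0 (Ordinal ik)) vA; rewrite !mxE => vAi.
  by rewrite -[RHS]vAi; apply: eq_bigr => j' _; rewrite mxE.
pose X : 'rV[C]_k := \row_i x (M + i)%N.
have [y yA] : exists y, y *m A = X by exists (X *m invmx A); rewrite mulmxKV.
exists (fun j => y 0 j) => w Mw; apply/eqP; rewrite -subr_eq0; apply/eqP.
rewrite -mulN1r; apply: (@rho_determined M (fun v => x v + -1 * \sum_j y 0 j * D j v)) => // [u Mu|i ik].
  by rewrite rho_lin rx // rD // mulr0 addr0.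
have := congr1 (fun B : 'rV_k => B 0 (Ordinal ik)) yA; rewrite !mxE /= => yAi.
rewrite mulN1r; apply/eqP; rewrite subr_eq0; apply/eqP; rewrite -yAi.
by apply: eq_bigr => j _; rewrite ?mxE.
Qed.

Let phiJ j : fps R n.+2 := phi a p beta (l j) (J j).

Let phiJ_approx j : cbound (fun al => phiJ j al - wseries a (D j) al).
Proof. exact: phi_approx. Qed.

Let wseries_comb (y : 'I_k -> C) al :
  wseries a (fun w => \sum_j y j * D j w) al = \sum_j y j * wseries a (D j) al.
Proof. by rewrite /wseries mulr_suml; apply: eq_bigr => j _; rewrite mulrA. Qed.

Let comb_approx (y : 'I_k -> C) : cbound (fun al =>
  \sum_j y j * phiJ j al - wseries a (fun w => \sum_j y j * D j w) al).
Proof.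
apply: (cbound_ext (f := fun al => \sum_j y j * (phiJ j al - wseries a (D j) al))).
  by move=> al; rewrite wseries_comb -sumrB; apply: eq_bigr => j _; rewrite mulrBr.
by apply: cbound_sum => j; apply: cboundZ.
Qed.

Let combE (y : 'I_k -> C) al :
  (\sum_j fscale (y j) (phiJ j)) al = \sum_j y j * phiJ j al.
Proof. by rewrite fct_sumE. Qed.

Lemma ext0_basis (s : \bar R) : ((c%:R / k%:R : R)%:E <= s)%E ->
  direct_sum_mod_convergent (ext0_lift a p beta s) phiJ.
Proof.
move=> hs; have c0 := a_pos ord_max; split.
  apply/seteqP; split=> f.
    move=> [_ /(annihilatedP a_pos a_le_last a_gcd)[d [fd rd]]] /=.
    (* A slow d' absorbs the defect [rho d]; d - d' is then a genuine solution for large weights,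
       hence a combination of the D j, and d' contributes only a convergent series. *)
    have [d' [M [gd' rd']]] := rho_slow_solve beta c0 a_lt_last rd.
    have [|w Mw|y hy] := @etrans_phi_span (maxn M Jmax) (fun w => d w + -1 * d' w).
    - exact: leq_maxr.
    - by rewrite rho_lin rd' ?mulN1r ?subrr // (leq_trans (leq_maxl _ _) Mw).
    exists y; apply/convergentP.
    have ge : grow c (fun w => d w + -1 * (\sum_j y j * D j w)).
      apply: (grow_eq_tail (M := maxn M Jmax)) gd' => w Mw.
      by rewrite -hy //; ring.
    apply: cbound_ext (cboundB (cboundD fd (grow_wseries a_pos a_le_last ge)) (comb_approx y)) => al.
    rewrite [RHS](_ : _ = f al - (\sum_j fscale (y j) (phiJ j)) al) // combE.
    by rewrite /wseries; ring.
  move=> [y /convergentP fy].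
  have fd : cbound (fun al => f al - wseries a (fun w => \sum_j y j * D j w) al).
    apply: cbound_ext (cboundD fy (comb_approx y)) => al.
    rewrite [X in X + _](_ : _ = f al - (\sum_j fscale (y j) (phiJ j)) al) // combE.
    by rewrite addrA subrK.
  split.
    apply: (gbound_gevrey hs).
    have gD : grow k (fun w => \sum_j y j * D j w).
      apply: grow_sum => j; apply: growZ; exact: grow_etrans.
    have gw := grow_gbound a_pos (a_pos pen) (ltnW pen_lt_last) a_le_pen gD.
    have := gboundD (cbound_gbound (a_pos pen) (ltnW pen_lt_last) fd) gw.
    by rewrite (_ : (fun al => _) = f) //; apply/funext => al; rewrite subrK.
  apply/(annihilatedP a_pos a_le_last a_gcd); exists (fun w => \sum_j y j * D j w); split=> //.
  apply: (grow_eq_tail (M := Jmax)) (grow0 R c) => w Jw.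
  by rewrite rho_sum big1 // => j _; rewrite rho_etrans_phi ?mulr0.
move=> y /convergentP fy.
have /(wseries_grow a_pos a_gcd) gD : cbound (wseries a (fun w => \sum_j y j * D j w)).
  apply: cbound_ext (cboundB fy (comb_approx y)) => al.
  by rewrite combE opprB addrC subrK.
(* A convergent combination is a slow solution, so it vanishes for large weights and freeness
   applies. *)
have [|M] := @rho_slow_kernel _ _ _ _ beta _ c0 a_lt_last _ Jmax gD; last exact: etrans_phi_free.
by move=> w Jw; rewrite rho_sum big1 // => j _; rewrite rho_etrans_phi ?mulr0.
Qed.

End Basis.
End Assembly.

Theorem theorem5p5 (R : realType) (n : nat) (a : 'I_n.+2 -> nat)
    (a_gt0 : (0 < a ord0)%N)
    (a_incr : forall i j : 'I_n.+2, (i < j)%N -> (a i < a j)%N)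
    (a_gcd : \big[gcdn/0%N]_(i < n.+2) a i = 1%N)
    (p : 'rV[R[i]]_n.+2)
    (pY : p 0 ord_max = 0) (pZ : p 0 (penult n) <> 0)
    (beta : R[i]) (s : \bar R)
    (hs : (((a ord_max)%:R / (a (penult n))%:R : R)%:E <= s)%E)
    (l : 'I_(a (penult n)) -> R[i])
    (hl : forall j, cexp (l j) = p 0 (penult n)) :
  ((~ exists b : nat, beta = b%:R) ->
     direct_sum_mod_convergent (ext0_lift a p beta s)
       (fun j : 'I_(a (penult n)) => phi a p beta (l j) j))
  /\
  (forall b : nat, beta = b%:R ->
     exists q : 'I_(a (penult n)),
       unique (fun q' : 'I_(a (penult n)) =>
         exists m : nat, (beta - (q' : nat)%:R) / (a (penult n))%:R = m%:R) q /\
       direct_sum_mod_convergent (ext0_lift a p beta s)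
         (fun j : 'I_(a (penult n)) =>
            if j == q then phi_tilde a p b else phi a p beta (l j) j)).
Proof.
move/eqP: pZ => pZ.
have k0 : (0 < a (penult n))%N.
  have [e|i0] := eqVneq (penult n) ord0; first by rewrite e.
  by apply: leq_ltn_trans (a_incr ord0 _ _); rewrite // lt0n.
set k := a (penult n) in k0 *.
have kn0 : k%:R != 0 :> R[i] by rewrite pnatr_eq0 -lt0n.
have expE (b j m : nat) : (b%:R - j%:R) / k%:R = m%:R :> R[i] -> b = (j + k * m)%N.
  move=> h; apply/eqP; rewrite -(eqr_nat R[i]) natrD natrM -h mulrC divfK //.
  by rewrite addrC subrK.
split=> [nb|b bE].
  apply: (ext0_basis a_gt0 a_incr a_gcd pY pZ hl) => // j m; apply/eqP => h.
  apply: nb; exists (j + k * m)%N; rewrite natrD natrM -h mulrC divfK //.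
  by rewrite addrC subrK.
pose q : 'I_k := Ordinal (ltn_pmod b k0); exists q; split.
  split; first by exists (b %/ k)%N; rewrite bE {1}(divn_eq b k) /= natrD addrK natrM mulfK.
  move=> q' [m]; rewrite bE => /expE e; apply: val_inj => /=.
  by rewrite e addnC mulnC modnMDl modn_small.
(* With J q = q the exponent would be a natural number and the sequence finite. The next index of
   the class after b is b + k, where the exponent is -1. *)
pose J (j : 'I_k) := if j == q then (b + k)%N else j : nat.
have -> : (fun j : 'I_k => if j == q then phi_tilde a p b else phi a p beta (l j) j) =
    (fun j => phi a p beta (l j) (J j)).
  apply/funext => j; rewrite /J; case: eqP => // ->.
  by rewrite (phi_tildeE b k0 (hl q)) bE.
apply: (ext0_basis a_gt0 a_incr a_gcd pY pZ hl) => // [j|j m].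
  rewrite /J; case: eqP => // ->; by rewrite modnDr /= modn_mod.
apply/eqP; rewrite /J bE; case: eqP => [_|jq] /expE; first by lia.
by move=> e; apply: jq; apply: val_inj => /=; rewrite e addnC mulnC modnMDl modn_small.
Qed.
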